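(* Let $X$ be a Banach $C(K_X)$-module, $Y$ a Banach $C(K_Y)$-module, and let $T:X\to Y$ be a bounded linear operator. The following are equivalent. (1) For any $x,y\in X$, $x\,d\,y$ in $X$ implies $T(x)\,d\,T(y)$ in $Y$. (2) For each $x\in X$, $T(X(x))\subseteq Y(T(x))$ and $T|_{X(x)}:X(x)\to Y(T(x))$ is a disjointness preserving operator between Banach lattices.
   Context: All spaces are over $\mathbb{C}$. Banach $C(K)$-module: $K$ is a compact Hausdorff space, $X$ a Banach space, $m:C(K)\to L(X)$ a bounded unital homomorphism, where $L(X)$ is the algebra of bounded linear operators. It is assumed that $m$ is injective and isometric (it is not assumed here that $m(C(K))$ is weak-operator closed); $f\in C(K)$ is identified with $m(f)$. For $x\in X$ the cyclic subspace $X(x)=\mathrm{cl}\{fx: f\in C(K)\}$, with the norm of $X$ and the cone $X_+(x)=\mathrm{cl}\{fx: f\in C(K), f\ge0\}$, is a (complex) Banach lattice. For $x\in X$ let $\Delta(x)=\mathrm{cl}\{fx: f\in C(K),\ \|f\|\le1\}$ (norm closure). Elements $x,y\in X$ are called disjoint, written $x\,d\,y$, if $\Delta(x+y)=\Delta(x)+\Delta(y)$ and $\Delta(x)\cap\Delta(y)=\{0\}$. An operator between Banach lattices is disjointness preserving if $u\perp v$ implies $Tu\perp Tv$. *)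

(* Defs.v *)
From HB Require Import structures.
From mathcomp Require Import all_boot all_order all_algebra.
From mathcomp Require Import all_classical all_reals all_analysis.
From mathcomp Require Import complex.
Import Order.TTheory GRing.Theory Num.Theory.
Import numFieldNormedType.Exports.

Set Implicit Arguments.
Unset Strict Implicit.
Unset Printing Implicit Defensive.

Local Open Scope classical_set_scope.
Local Open Scope ring_scope.
Local Open Scope complex_scope.

(* C(K). The library attaches the norm topology of R[i] to its alias R[i]^o. *)
Notation Cfun R K := (continuousType K (complex R)^o).

Section CfunAlgebra.
Context {R : realType} {K : topologicalType}.
Implicit Types f g h : Cfun R K.

Definition mkcfun (f : K -> R[i]^o) (fc : continuous f) : Cfun R K :=
  HB.pack f (isContinuous.Build K (R[i]^o) f fc).

Fact cfun_add_subproof f g : continuous (fun t => f t + g t).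
Proof. by move=> t; apply: (@continuousD _ (R[i]^o)); exact: cts_fun. Qed.

Fact cfun_opp_subproof f : continuous (fun t => - f t).
Proof. by move=> t; apply: (@continuousN _ (R[i]^o)); exact: cts_fun. Qed.

Fact cfun_mul_subproof f g : continuous (fun t => f t * g t).
Proof. by move=> t; apply: (@cvgM _ _ (nbhs t)); exact: cts_fun. Qed.

Fact cfun_cst_subproof (c : R[i]^o) : continuous (fun _ : K => c).
Proof. by move=> t; exact: cst_continuous. Qed.

Definition cfun_add f g := mkcfun (@cfun_add_subproof f g).
Definition cfun_opp f := mkcfun (@cfun_opp_subproof f).
Definition cfun_mul f g := mkcfun (@cfun_mul_subproof f g).
Definition cfun_cst c := mkcfun (@cfun_cst_subproof c).

Fact cfun_addA : associative cfun_add.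
Proof. by move=> f g h; apply/continuousEP => t; exact: addrA. Qed.
Fact cfun_addC : commutative cfun_add.
Proof. by move=> f g; apply/continuousEP => t; exact: addrC. Qed.
Fact cfun_add0 : left_id (cfun_cst 0) cfun_add.
Proof. by move=> f; apply/continuousEP => t; exact: add0r. Qed.
Fact cfun_addN : left_inverse (cfun_cst 0) cfun_opp cfun_add.
Proof. by move=> f; apply/continuousEP => t; exact: addNr. Qed.

HB.instance Definition _ :=
  GRing.isZmodule.Build (Cfun R K) cfun_addA cfun_addC cfun_add0 cfun_addN.

Fact cfun_mulA : associative cfun_mul.
Proof. by move=> f g h; apply/continuousEP => t; exact: mulrA. Qed.
Fact cfun_mulC : commutative cfun_mul.
Proof. by move=> f g; apply/continuousEP => t; exact: mulrC. Qed.
Fact cfun_mul1 : left_id (cfun_cst 1) cfun_mul.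
Proof. by move=> f; apply/continuousEP => t; exact: mul1r. Qed.
Fact cfun_mulD : left_distributive cfun_mul (@GRing.add (Cfun R K)).
Proof. by move=> f g h; apply/continuousEP => t; exact: mulrDl. Qed.

HB.instance Definition _ :=
  GRing.Zmodule_isComPzRing.Build (Cfun R K)
    cfun_mulA cfun_mulC cfun_mul1 cfun_mulD.

Definition cfun_scale (c : R[i]) f := cfun_mul (cfun_cst c) f.

Fact cfun_scaleA c d f : cfun_scale c (cfun_scale d f) = cfun_scale (c * d) f.
Proof. by apply/continuousEP => t; exact: mulrA. Qed.
Fact cfun_scale1 : left_id 1 cfun_scale.
Proof. by move=> f; apply/continuousEP => t; exact: mul1r. Qed.
Fact cfun_scaleDr : right_distributive cfun_scale +%R.
Proof. by move=> c f g; apply/continuousEP => t; exact: mulrDr. Qed.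
Fact cfun_scaleDl f : {morph cfun_scale^~ f : c d / c + d}.
Proof. by move=> c d; apply/continuousEP => t; exact: mulrDl. Qed.

HB.instance Definition _ :=
  GRing.Zmodule_isLmodule.Build R[i] (Cfun R K)
    cfun_scaleA cfun_scale1 cfun_scaleDr cfun_scaleDl.

Lemma cfunDE f g t : (f + g) t = f t + g t. Proof. by []. Qed.
Lemma cfunNE f t : (- f) t = - f t. Proof. by []. Qed.
Lemma cfunME f g t : (f * g) t = f t * g t. Proof. by []. Qed.
Lemma cfun0E t : (0 : Cfun R K) t = 0. Proof. by []. Qed.
Lemma cfun1E t : (1 : Cfun R K) t = 1. Proof. by []. Qed.
Lemma cfunZE (c : R[i]) f t : (c *: f) t = c * f t. Proof. by []. Qed.

(* [sup set0] is 0, as wanted when K is empty. *)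
Definition cfun_norm f : R := sup [set complex.Re `|f t| | t in [set: K]].

End CfunAlgebra.

(* Only meaningful for bounded A; the unit ball contains 0, so that the
   supremum is over a nonempty set even when V is trivial. *)
Definition op_norm (R : realType) (V W : normedModType R[i]) (A : V -> W) : R :=
  sup [set complex.Re `|A v| | v in [set v : V | `|v| <= 1]].

Record ck_module (R : realType) (K : topologicalType)
    (X : completeNormedModType R[i]) := CKModule {
  ck_act :> Cfun R K -> {linear X -> X} ;
  ck_act_bounded : forall f, bounded_near (ck_act f) (nbhs (0 : X)) ;
  ck_actD : forall f g x, ck_act (f + g) x = ck_act f x + ck_act g x ;
  ck_actZ : forall (c : R[i]) f x, ck_act (c *: f) x = c *: ck_act f x ;
  ck_actM : forall f g x, ck_act (f * g) x = ck_act f (ck_act g x) ;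
  ck_act1 : forall x, ck_act 1 x = x ;
  ck_bounded : exists M : R,
    forall f, op_norm (ck_act f) <= M * cfun_norm f ;
  ck_injective : forall f g, (forall x, ck_act f x = ck_act g x) -> f = g ;
  ck_isometric : forall f, op_norm (ck_act f) = cfun_norm f
}.

Section CyclicSubspace.
Context {R : realType} {K : topologicalType} {X : completeNormedModType R[i]}.
Variable m : ck_module K X.

Definition cyclic (x : X) : set X :=
  closure [set m f x | f in [set: Cfun R K]].

(* In the order of [R[i]], [0 <= z] says that z is real and nonnegative. *)
Definition cyclic_cone (x : X) : set X :=
  closure [set m f x | f in [set f : Cfun R K | forall t, 0 <= f t]].

Definition Delta (x : X) : set X :=
  closure [set m f x | f in [set f : Cfun R K | cfun_norm f <= 1]].

Definition ck_disjoint (x y : X) : Prop :=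
  Delta (x + y) = [set u + v | u in Delta x & v in Delta y] /\
  Delta x `&` Delta y = [set 0].

End CyclicSubspace.

(* A complex Banach lattice sitting inside E is described by its carrier L and
   its positive cone P: its real part is P - P, ordered by
   u <= v iff v - u \in P, and L is the complexification of P - P. *)
Section ComplexLattice.
Context {R : realType} {E : lmodType R[i]}.
Variable P : set E.

Definition real_part : set E := [set u - v | u in P & v in P].

Definition cone_le (u v : E) : Prop := P (v - u).

Definition is_lub_in (A : set E) (s : E) : Prop :=
  [/\ real_part s, (forall a, A a -> cone_le a s) &
    forall b, real_part b -> (forall a, A a -> cone_le a b) -> cone_le s b].

Definition is_glb_in (A : set E) (s : E) : Prop :=
  [/\ real_part s, (forall a, A a -> cone_le s a) &
    forall b, real_part b -> (forall a, A a -> cone_le b a) -> cone_le b s].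

(* |a + ib| = sup {cos t a + sin t b : t real}, for a and b real *)
Definition is_modulus (z p : E) : Prop :=
  exists a b, [/\ real_part a, real_part b, z = a + 'i *: b &
    is_lub_in [set (cos t)%:C *: a + (sin t)%:C *: b | t in [set: R]] p].

Definition lattice_disjoint (u v : E) : Prop :=
  exists p q, [/\ is_modulus u p, is_modulus v q & is_glb_in [set p; q] 0].

End ComplexLattice.

Definition disjointness_preserving (R : realType) (E F : lmodType R[i])
    (L P : set E) (Q : set F) (T : E -> F) : Prop :=
  forall u v, L u -> L v ->
    lattice_disjoint P u v -> lattice_disjoint Q (T u) (T v).

(* Main.v *)
(* Both sides are expressed through approximate separation: [sep u v] says that
   some functions 0 <= h <= 1 satisfy hu -> u and hv -> 0. Since
   |f| <= |g| implies |fx| <= |gx| in norm, the lattice operations of a cyclic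
   subspace X(z) are limits of pointwise operations on functions f with fz close
   to the given vector; hence [sep u v] is equivalent to u d v, and, for u, v in
   X(z), to disjointness in the lattice X(z).

   What remains is that a [sep]-preserving T maps fx into Y(Tx). Let
   0 <= f <= 1. For k < N the unit function splits as a_k + l_k + g_k, where a_k
   lives on f > (k + 1/2)/N, l_k on f < (k + 1/2)/N, and g_k is a tent on
   k/N < f < (k+1)/N, so that N f = sum_k (a_k + g_k/2). If h_k separates
   T(a_k x) from T(l_k x), then N T(fx) - (sum_k h_k) Tx is close to
   sum_k (1/2 - h_k) T(g_k x). The tents being disjoint, the norm of this sum is
   at most that of T((sum_k g_k) x), which is bounded independently of N. *)
Require Import Defs.
From mathcomp Require Import all_boot all_order all_algebra.
From mathcomp Require Import all_classical all_reals all_analysis.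
From mathcomp Require Import complex.
From mathcomp Require Import ring lra.
Import Order.TTheory GRing.Theory Num.Theory.
Import numFieldNormedType.Exports.

Set Implicit Arguments.
Unset Strict Implicit.
Unset Printing Implicit Defensive.

Local Open Scope classical_set_scope.
Local Open Scope ring_scope.
Local Open Scope complex_scope.

(* Reflexive decision of equalities in an abelian group, by comparing the
   integer coefficients of the atoms. *)
Inductive aexp := AVar of nat | AZero | AAdd of aexp & aexp | AOpp of aexp.

Section Abel.
Variable V : zmodType.

Fixpoint aeval (s : seq V) e : V :=
  match e with
  | AVar n => nth 0 s n
  | AZero => 0
  | AAdd e1 e2 => aeval s e1 + aeval s e2
  | AOpp e1 => - aeval s e1
  end.

Fixpoint acoef (e : aexp) (i : nat) : int :=
  match e with
  | AVar n => (n == i)%:Z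
  | AZero => 0
  | AAdd e1 e2 => acoef e1 i + acoef e2 i
  | AOpp e1 => - acoef e1 i
  end.

Lemma aevalE s e :
  aeval s e = \sum_(i < size s) nth 0 s i *~ acoef e i.
Proof.
elim: e => [n||e1 IH1 e2 IH2|e1 IH1] /=.
- have [ns|sn] := ltnP n (size s).
    rewrite (bigD1 (Ordinal ns)) //= eqxx mulr1z big1 ?addr0 // => i /eqP ni.
    have [E|] := eqVneq n i; last by rewrite mulr0z.
    by case: ni; exact: val_inj.
  rewrite nth_default // big1 // => i _.
  by rewrite gtn_eqF ?mulr0z // (leq_trans (ltn_ord i) sn).
- by rewrite big1 // => i _; rewrite mulr0z.
- by rewrite IH1 IH2 -big_split; apply: eq_bigr => i _; rewrite mulrzDr.
- by rewrite IH1 -sumrN; apply: eq_bigr => i _; rewrite mulrNz.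
Qed.

(** Only the atoms in range matter: a variable beyond the end of [s] evaluates to the default 0. *)
Lemma aeval_eq s e1 e2 :
  all (fun i => acoef e1 i == acoef e2 i) (iota 0 (size s)) ->
  aeval s e1 = aeval s e2.
Proof.
move=> /allP h; rewrite !aevalE; apply: eq_bigr => i _.
by rewrite (eqP (h i _)) // mem_iota add0n ltn_ord.
Qed.

End Abel.

(* Atoms are compared up to conversion: the same vector can occur with
   different structure projections. *)
Ltac atom_index s x :=
  match s with
  | ?y :: ?s' => match constr:(Set) with
      | _ => let _ := match constr:(Set) with _ => unify x y end in
             constr:(0%N)
      | _ => let n := atom_index s' x in constr:(S n)
      end
  end.

Ltac atoms s t :=
  match t with
  | @Algebra.zero _ => s
  | @Algebra.add _ ?a ?b => let s := atoms s a in atoms s b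
  | @Algebra.opp _ ?a => atoms s a
  | _ => match constr:(Set) with
         | _ => let _ := atom_index s t in s
         | _ => constr:(t :: s)
         end
  end.

Ltac areify s t :=
  match t with
  | @Algebra.zero _ => constr:(AZero)
  | @Algebra.add _ ?a ?b =>
      let a := areify s a in let b := areify s b in constr:(AAdd a b)
  | @Algebra.opp _ ?a => let a := areify s a in constr:(AOpp a)
  | _ => let n := atom_index s t in constr:(AVar n)
  end.

Ltac abel_at V :=
  match goal with
  | |- @eq _ ?l ?r =>
      let s := atoms (@nil V) l in
      let s := atoms s r in
      let l' := areify s l in
      let r' := areify s r in
      apply: (@aeval_eq V s l' r'); vm_compute; reflexivity
  end.

(** * Real-valued norms and completeness *)

(** Norms take values in [R[i]], whose order is partial; the real part loses nothing and makes [lra]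
    applicable. *)
Definition nr (R : realType) (V : completeNormedModType R[i]) (v : V) : R :=
  complex.Re `|v|.

Section NormR.
Context {R : realType}.

Section Normed.
Context {V : completeNormedModType R[i]}.
Implicit Types u v w : V.

Lemma nrE v : `|v| = (nr v)%:C.
Proof. by rewrite /nr RRe_real // normr_real. Qed.

Lemma nr_ge0 v : 0 <= nr v.
Proof. by rewrite -lecR -nrE normr_ge0. Qed.

Lemma nrD u v : nr (u + v) <= nr u + nr v.
Proof. by rewrite -lecR rmorphD /= -!nrE ler_normD. Qed.

Lemma nrN v : nr (- v) = nr v.
Proof. by rewrite /nr normrN. Qed.

Lemma nrB u v : nr (u - v) = nr (v - u).
Proof. by rewrite -nrN opprB. Qed.

Lemma nr_tri w u v : nr (u - v) <= nr (u - w) + nr (w - v).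
Proof. by rewrite -[u - v](subrKA w) nrD. Qed.

Lemma nr0 : nr (0 : V) = 0.
Proof. by rewrite /nr normr0. Qed.

Lemma nr0_eq0 v : nr v = 0 -> v = 0.
Proof. by move=> v0; apply/eqP; rewrite -normr_eq0 nrE v0. Qed.

Lemma nrD3 u v w : nr (u + v + w) <= nr u + nr v + nr w.
Proof. by apply: le_trans (nrD _ _) _; rewrite lerD2r nrD. Qed.

Lemma nrD4 u v w x : nr (u + v + w + x) <= nr u + nr v + nr w + nr x.
Proof. by apply: le_trans (nrD _ _) _; rewrite lerD2r nrD3. Qed.

Lemma nr_small_eq0 v : (forall e, 0 < e -> nr v <= e) -> v = 0.
Proof.
move=> h; apply: nr0_eq0; apply/eqP; rewrite eq_le nr_ge0 andbT.
by apply/ler_addgt0Pl => e e0; rewrite addr0 h.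
Qed.

Lemma nrZ (c : R[i]) v : nr (c *: v) = complex.Re `|c| * nr v.
Proof. by rewrite /nr normrZ nrE normc_def -rmorphM. Qed.

Lemma ball_nrE u v (e : R) : ball u e%:C v = (nr (u - v) < e) :> Prop.
Proof. by rewrite -ball_normE /= nrE ltcR. Qed.

End Normed.

Lemma closure_nrP (V : completeNormedModType R[i]) (A : set V) (u : V) :
  closure A u <-> forall e, 0 < e -> exists2 a, A a & nr (u - a) < e.
Proof.
split=> [uA e e0|h B].
  have := uA (ball u e%:C); case.
    by apply: nbhsx_ballx; rewrite ltcR.
  by move=> a [Aa]; rewrite ball_nrE; exists a.
move=> /nbhs_ballP[e /= e0 eB].
(* A positive element of [R[i]] is real, so every ball radius comes from [R]. *)
have ee : e = (complex.Re e)%:C by rewrite RRe_real // gtr0_real.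
case: (h (complex.Re e)); first by rewrite -ltcR -ee.
move=> a Aa ua; exists a; split=> //; apply: eB.
by rewrite ee ball_nrE.
Qed.

(* [phi i] is known to within [d i] of the limit to be constructed. *)
Lemma complete_ext (I : Type) (X : completeNormedModType R[i]) (phi : I -> X)
    (d : I -> R) :
  (forall i j, nr (phi i - phi j) <= d i + d j) ->
  (forall e, 0 < e -> exists i, d i < e) ->
  exists L, forall i, nr (phi i - L) <= d i.
Proof.
move=> phid dinf.
have /choice[s sP] : forall n : nat, exists i, d i < n.+1%:R^-1.
  by move=> n; apply: dinf; rewrite invr_gt0.
have sn n m : (n <= m)%N -> d (s m) < n.+1%:R^-1.
  move=> nm; apply: lt_le_trans (sP m) _.
  by rewrite lef_pV2 ?posrE // ler_nat.
have ex (e : R) : 0 < e -> exists n : nat, n.+1%:R^-1 < e.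
  move=> e0; exists (Num.truncn e^-1).
  by rewrite invf_plt ?posrE // Num.Theory.truncnS_gt.
have cv : cvg (phi (s n) @[n --> \oo]).
  apply: cauchy_cvg; apply: cauchy_exP => e e0.
  have ee : e = (complex.Re e)%:C by rewrite RRe_real // gtr0_real.
  have [|n nP] := ex (complex.Re e / 2).
    by rewrite divr_gt0 // -ltcR -ee.
  exists (phi (s n)); exists n => // m /= nm.
  rewrite ee ball_nrE.
  have := phid (s n) (s m); have := sn _ _ (leqnn n); have := sn _ _ nm.
  by move: nP; move: (n.+1%:R^-1) (complex.Re e) => q E; lra.
(* The limit along [s] serves every [i]: compare [phi i] with [phi (s m)] and let [m] grow. *)
exists (lim (phi (s n) @[n --> \oo])) => i.
apply/ler_addgt0Pl => e e0.
have [|n nP] := ex (e / 2); first by rewrite divr_gt0.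
move/cvgrPdist_lt : cv => /(_ (e / 2)%:C).
rewrite ltcR divr_gt0 // => /(_ isT) [m _ /= mP].
have := mP (maxn n m) (leq_maxr _ _); rewrite nrE ltcR.
have := sn _ _ (leq_maxl n m); have := phid i (s (maxn n m)).
have := nr_tri (phi (s (maxn n m))) (phi i) (lim (phi (s n) @[n --> \oo])).
rewrite [nr (lim _ - _)]nrB; move: nP; move: (n.+1%:R^-1) => q; lra.
Qed.

Lemma bounded_nrP (V W : completeNormedModType R[i]) (A : {linear V -> W}) :
  bounded_near A (nbhs (0 : V)) ->
  exists2 M : R, 0 < M & forall v, nr (A v) <= M * nr v.
Proof.
move=> /linear_boundedP[r [rR rP]].
pose M := Num.max 1 (complex.Re r + 1).
have M0 : 0 < M by rewrite lt_max ltr01.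
exists M => // v; rewrite -lecR rmorphM /= -!nrE; apply: rP.
by rewrite -(RRe_real rR) ltcR lt_max ltrDl ltr01 orbT.
Qed.

End NormR.

(** * Continuous functions *)

Section Functions.
Context {R : realType} {K : topologicalType}.
Implicit Types f g h k : Cfun R K.

Definition cabs (c : R[i]) : R := complex.Re `|c|.

Lemma cabsE (c : R[i]) : `|c| = (cabs c)%:C.
Proof. by rewrite /cabs normc_def. Qed.

Lemma cabsM (c d : R[i]) : cabs (c * d) = cabs c * cabs d.
Proof. by rewrite /cabs normrM !cabsE -rmorphM. Qed.

Lemma cabsD (c d : R[i]) : cabs (c + d) <= cabs c + cabs d.
Proof. by rewrite -lecR rmorphD /= -!cabsE ler_normD. Qed.

Lemma cabsN (c : R[i]) : cabs (- c) = cabs c.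
Proof. by rewrite /cabs normrN. Qed.

Lemma cabsB (c d : R[i]) : cabs (c - d) = cabs (d - c).
Proof. by rewrite -cabsN opprB. Qed.

Lemma cabs_tri (e c d : R[i]) : cabs (c - d) <= cabs (c - e) + cabs (e - d).
Proof. by rewrite -[c - d](subrKA e) cabsD. Qed.

Lemma cabs_ge0 (c : R[i]) : 0 <= cabs c.
Proof. by rewrite -lecR -cabsE normr_ge0. Qed.

Lemma cabs_real (r : R) : cabs r%:C = `|r|.
Proof. by rewrite /cabs normc_def /= expr0n addr0 sqrtr_sqr. Qed.

Lemma cabs_sqrt (c : R[i]) :
  cabs c = Num.sqrt (complex.Re c ^+ 2 + complex.Im c ^+ 2).
Proof. by rewrite /cabs normc_def. Qed.

Lemma cabs_sqr (c : R[i]) :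
  cabs c ^+ 2 = complex.Re c ^+ 2 + complex.Im c ^+ 2.
Proof. by rewrite cabs_sqrt sqr_sqrtr // addr_ge0 // sqr_ge0. Qed.

Lemma cabs_Re (c : R[i]) : `|complex.Re c| <= cabs c.
Proof. by rewrite -lecR -cabsE normc_ge_Re. Qed.

Lemma cabs_Im (c : R[i]) : `|complex.Im c| <= cabs c.
Proof.
rewrite cabs_sqrt -sqrtr_sqr ler_sqrt ?lerDr ?sqr_ge0 //.
by rewrite addr_ge0 // sqr_ge0.
Qed.

Lemma cabs_le_ReIm (c : R[i]) : cabs c <= `|complex.Re c| + `|complex.Im c|.
Proof.
rewrite -ler_sqr ?nnegrE ?cabs_ge0 ?addr_ge0 // cabs_sqr.
rewrite -(normr_id (complex.Re c)) sqrrD !real_normK ?num_real //.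
by rewrite lerD2r lerDl mulrn_wge0 // mulr_ge0.
Qed.

Lemma cabs_lip (c d : R[i]) : `|cabs c - cabs d| <= cabs (c - d).
Proof.
have := cabs_tri d c 0; have := cabs_tri c d 0.
rewrite !subr0 [cabs (d - c)]cabsB ler_norml; lra.
Qed.

Lemma lipschitz_cont (F : R[i] -> R) f :
  (forall c d, `|F c - F d| <= cabs (c - d)) ->
  continuous (fun t => F (f t)).
Proof.
move=> Flip t; apply/cvgrPdist_lt => e e0.
have /cvgrPdist_lt/(_ e%:C) := @cts_fun _ _ f t.
rewrite ltcR e0 => /(_ isT); apply: filterS => s.
by rewrite cabsE ltcR; apply: le_lt_trans (Flip _ _).
Qed.

Lemma real_complex_cont (r : K -> R) :
  continuous r -> continuous (fun t => (r t)%:C : R[i]^o).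
Proof.
move=> rc t; apply/cvgrPdist_lt => e e0.
have ee : e = (complex.Re e)%:C by rewrite RRe_real // gtr0_real.
have /cvgrPdist_lt/(_ (complex.Re e)) := rc t.
rewrite -ltcR -ee e0 => /(_ isT); apply: filterS => s.
by rewrite -rmorphB cabsE cabs_real ee ltcR.
Qed.

Definition rfun (r : K -> R) (rc : continuous r) : Cfun R K :=
  mkcfun (real_complex_cont rc).

Lemma cabs_cont f : continuous (fun t => cabs (f t)).
Proof. by apply: lipschitz_cont => c d; exact: cabs_lip. Qed.

Lemma Re_cont f : continuous (fun t => complex.Re (f t)).
Proof.
apply: lipschitz_cont => c d; rewrite -raddfB; exact: cabs_Re.
Qed.

Lemma Im_cont f : continuous (fun t => complex.Im (f t)).
Proof.
apply: lipschitz_cont => c d; rewrite -raddfB; exact: cabs_Im.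
Qed.

Definition conjfun f : Cfun R K := rfun (@Re_cont f) - 'i *: rfun (@Im_cont f).

Lemma conjfunE f t : conjfun f t = (f t)^*%C.
Proof.
rewrite /conjfun cfunDE cfunNE cfunZE /=.
by case: (f t) => a b; simpc.
Qed.

(* h = k f^* / (|f|^2 + eta^2). *)
Lemma approx_factor k f (eta : R) : 0 < eta ->
  (forall t, cabs (k t) <= cabs (f t)) ->
  exists h, (forall t, cabs (h t) <= 1) /\
            (forall t, cabs ((k - h * f) t) <= eta).
Proof.
move=> eta0 kf.
have D0 t : 0 < cabs (f t) ^+ 2 + eta ^+ 2.
  by rewrite ltr_wpDl ?sqr_ge0 // exprn_gt0.
pose r t := (cabs (f t) ^+ 2 + eta ^+ 2)^-1.
have rc : continuous r.
  move=> t; apply: cvgV; first by rewrite gt_eqF.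
  apply: cvgD; last exact: cvg_cst.
  by apply: (@cvgM _ _ (nbhs t)); exact: cabs_cont.
have r0 t : 0 <= r t by rewrite invr_ge0 ltW.
exists (rfun rc * k * conjfun f); split=> t.
  rewrite !cfunME conjfunE /= !cabsM cabs_real ger0_norm //.
  have -> : cabs (f t)^*%C = cabs (f t).
    by case: (f t) => a b; rewrite !cabs_sqrt /= sqrrN.
  rewrite /r -mulrA mulrC ler_pdivrMr // mul1r.
  apply: (@le_trans _ _ (cabs (f t) ^+ 2)); last by rewrite lerDl sqr_ge0.
  by rewrite expr2 ler_wpM2r ?cabs_ge0.
rewrite cfunDE cfunNE !cfunME conjfunE /=.
(* The remainder is [eta^2 k / (|f|^2 + eta^2)], at most [eta] because [|k| <= |f|] and
   [eta |f| <= |f|^2 + eta^2]. *)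
have -> : k t - (r t)%:C * k t * (f t)^*%C * f t = (r t * eta ^+ 2)%:C * k t.
  have -> : (r t)%:C * k t * (f t)^*%C * f t = (r t * cabs (f t) ^+ 2)%:C * k t.
    rewrite cabs_sqr; case: (f t) (k t) => a b [c d].
    by simpc; congr (_ +i* _); rewrite /=; ring.
  rewrite -{1}[k t]mul1r -mulrBl; congr (_ * _).
  rewrite -(rmorph1 (real_complex R)) -rmorphB; congr (_%:C).
  rewrite -(mulVf (x := cabs (f t) ^+ 2 + eta ^+ 2)) ?gt_eqF //.
  by rewrite -mulrBr addrAC subrr add0r.
have h : 0 <= r t * eta ^+ 2 by rewrite mulr_ge0 ?sqr_ge0.
rewrite cabsM cabs_real ger0_norm // /r -mulrA mulrC ler_pdivrMr //.
apply: (@le_trans _ _ (eta * (eta * cabs (f t)))).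
  by rewrite mulrA -expr2 ler_wpM2l ?sqr_ge0.
by rewrite ler_pM2l //; have := sqr_ge0 (cabs (f t) - eta); have := cabs_ge0 (f t); nra.
Qed.

End Functions.

(** * The module action *)

Section Module.
Context {R : realType} {K : topologicalType} {X : completeNormedModType R[i]}.
Variables (Kc : compact [set: K]) (m : ck_module K X).
Implicit Types (f g h k : Cfun R K) (x y z u v w : X).

Lemma act0 x : m 0 x = 0.
Proof. by rewrite -(scale0r (0 : Cfun R K)) ck_actZ scale0r. Qed.

Lemma actN f x : m (- f) x = - m f x.
Proof. by rewrite -scaleN1r ck_actZ scaleN1r. Qed.

Lemma actB f g x : m (f - g) x = m f x - m g x.
Proof. by rewrite ck_actD actN. Qed.

Lemma act_addx f x y : m f (x + y) = m f x + m f y.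
Proof. exact: linearD. Qed.

Lemma act_oppx f x : m f (- x) = - m f x.
Proof. exact: linearN. Qed.

Lemma act_scalex f c x : m f (c *: x) = c *: m f x.
Proof. exact: linearZ. Qed.

(* [ck_actZ] has to precede [ck_actM]: [c *: f] is convertible to a product. *)
Definition actE :=
  (ck_actZ, act_scalex, ck_actD, ck_actM, actB, actN, ck_act1, act_addx,
   act_oppx).

Lemma cfun_norm_le f c : 0 <= c -> (forall t, cabs (f t) <= c) ->
  cfun_norm f <= c.
Proof.
move=> c0 fc; rewrite /cfun_norm; set A := (X in sup X).
(* If [K] is empty the supremum is 0 by convention, and [0 <= c] settles the case. *)
have [->|/set0P A0] := eqVneq A set0; first by rewrite sup0.
by apply: ge_sup => // _ [t _ <-]; exact: fc.
Qed.

Lemma cfun_bounded f : exists2 M : R, 0 < M & forall t, cabs (f t) <= M.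
Proof.
have := continuous_compact (continuous_subspaceT (@cabs_cont R K f)) Kc.
move=> /compact_bounded[M [_ MP]].
exists (Num.max 1 (M + 1)) => [|t]; first by rewrite lt_max ltr01.
have := MP (Num.max 1 (M + 1)).
rewrite lt_max ltrDl ltr01 orbT => /(_ isT (cabs (f t))) /=.
by rewrite ger0_norm ?cabs_ge0 //; apply; exists t.
Qed.

Lemma cfun_norm_ge f t : cabs (f t) <= cfun_norm f.
Proof.
apply: sup_upper_bound; last by exists t.
split; first by exists (cabs (f t)), t.
by have [M _ fM] := cfun_bounded f; exists M => _ [s _ <-]; exact: fM.
Qed.

Lemma cfun_norm_le1 f : cfun_norm f <= 1 <-> forall t, cabs (f t) <= 1.
Proof.
split=> [f1 t|]; last exact: cfun_norm_le.
exact: le_trans (cfun_norm_ge f t) f1.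
Qed.

(** By isometry the operator norm of [m h] is the sup norm of [h]; the bound is read off at the
    normalised vector. *)
Lemma act_le h c x : 0 <= c -> (forall t, cabs (h t) <= c) ->
  nr (m h x) <= c * nr x.
Proof.
move=> c0 hc; have [->|x0] := eqVneq x 0; first by rewrite linear0 nr0 mulr0.
have nx : 0 < nr x.
  rewrite lt_neqAle nr_ge0 andbT eq_sym.
  by apply: contra_neq x0; exact: nr0_eq0.
pose v := ((nr x)^-1)%:C *: x.
have nv : nr v = 1.
  rewrite nrZ -/(cabs _) cabs_real ger0_norm ?invr_ge0 ?nr_ge0 //.
  by rewrite mulVf ?gt_eqF.
(* Boundedness of the action makes the supremum in [op_norm] a genuine upper bound. *)
have [M _ mM] := bounded_nrP (ck_act_bounded m h).
have hv : nr (m h v) <= c.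
  apply: le_trans (cfun_norm_le c0 hc); rewrite -(ck_isometric m).
  apply: sup_upper_bound.
    split; first by exists (nr (m h v)), v => //=; rewrite nrE nv.
    exists M => _ [w /= w1 <-]; move: w1; rewrite nrE -[1]/(1%:C) lecR => w1.
    have M0 : 0 <= M by have := mM v; rewrite nv mulr1; apply: le_trans; exact: nr_ge0.
    by apply: le_trans (mM w) _; rewrite ler_piMr.
  by exists v => //=; rewrite nrE nv.
have xv : x = (nr x)%:C *: v.
  by rewrite scalerA -rmorphM /= divff ?gt_eqF // scale1r.
rewrite [in m h x]xv linearZ nrZ -/(cabs _) cabs_real ger0_norm ?nr_ge0 //.
by rewrite mulrC ler_wpM2r ?nr_ge0.
Qed.

Lemma act_le1 h x : (forall t, cabs (h t) <= 1) -> nr (m h x) <= nr x.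
Proof. by move=> h1; have := act_le x ler01 h1; rewrite mul1r. Qed.

(** Up to a small error [k = h f] with [|h| <= 1], and such an [h] acts as a contraction. All
    lattice operations below rest on this monotonicity. *)
Lemma act_dom k f x : (forall t, cabs (k t) <= cabs (f t)) ->
  nr (m k x) <= nr (m f x).
Proof.
move=> kf; apply/ler_addgt0Pl => e e0.
(* Chosen so that [eta * nr x <= e]; the added 1 covers [x = 0]. *)
pose eta := e / (nr x + 1).
have x1 : 0 < nr x + 1 by rewrite ltr_wpDl ?nr_ge0.
have eta0 : 0 < eta by rewrite divr_gt0.
have [h [h1 hf]] := approx_factor eta0 kf.
have := act_le x (ltW eta0) hf; rewrite actB ck_actM => E.
have E2 : eta * nr x <= e.
  by rewrite /eta mulrAC ler_pdivrMr // ler_pM2l // lerDl.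
have := act_le1 (m f x) h1; have := nrD (m h (m f x)) (m k x - m h (m f x)).
rewrite addrC subrK; lra.
Qed.

End Module.

(** Expands actions and scalars down to atoms, which leaves an identity in the additive group. *)
Ltac module_eq V :=
  rewrite ?actE; rewrite ?(scalerDr, scalerN); abel_at V.

(** * Disjointness and approximate separation *)

Section Separation.
Context {R : realType} {K : topologicalType} {X : completeNormedModType R[i]}.
Variables (Kc : compact [set: K]) (m : ck_module K X).
Implicit Types (f g h k : Cfun R K) (x y z u v w : X).

Lemma cyclicP x u :
  cyclic m x u <-> forall e : R, 0 < e -> exists f, nr (m f x - u) < e.
Proof.
rewrite /cyclic closure_nrP; split=> H e /H.
  by case=> _ [f _ <-]; rewrite nrB; exists f.
by case=> f; rewrite nrB => fe; exists (m f x) => //; exists f.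
Qed.

Lemma DeltaP x u : Delta m x u <-> forall e : R, 0 < e ->
  exists2 f : Cfun R K, (forall t, cabs (f t) <= 1) & nr (m f x - u) < e.
Proof.
rewrite /Delta closure_nrP; split=> H e /H.
  by case=> _ [f /= /(cfun_norm_le1 Kc) f1 <-]; rewrite nrB; exists f.
case=> f f1; rewrite nrB => fe; exists (m f x) => //; exists f => //=.
exact/(cfun_norm_le1 Kc).
Qed.

Lemma coneP x u : cyclic_cone m x u <-> forall e : R, 0 < e ->
  exists2 f : Cfun R K, (forall t, 0 <= f t) & nr (m f x - u) < e.
Proof.
rewrite /cyclic_cone closure_nrP; split=> H e /H.
  by case=> _ [f /= f1 <-]; rewrite nrB; exists f.
by case=> f f1; rewrite nrB => fe; exists (m f x) => //; exists f.
Qed.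

Lemma cyclic_self x : cyclic m x x.
Proof. by apply/cyclicP => e e0; exists 1; rewrite ck_act1 subrr nr0. Qed.

Lemma cyclicD x u v :
  cyclic m x u -> cyclic m x v -> cyclic m x (u + v).
Proof.
move=> /cyclicP uP /cyclicP vP; apply/cyclicP => e e0.
have e2 : 0 < e / 2 by rewrite divr_gt0.
have [f fe] := uP _ e2; have [g ge] := vP _ e2.
exists (f + g).
have -> : m (f + g) x - (u + v) = (m f x - u) + (m g x - v) by module_eq X.
by have := nrD (m f x - u) (m g x - v); lra.
Qed.

Lemma cyclicZ (c : R[i]) x u : cyclic m x u -> cyclic m x (c *: u).
Proof.
move=> /cyclicP uP; apply/cyclicP => e e0.
have c1 : 0 < cabs c + 1 by rewrite ltr_wpDl ?cabs_ge0.
have [|f fe] := uP (e / (cabs c + 1)); first by rewrite divr_gt0.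
exists (c *: f); rewrite ck_actZ -scalerBr nrZ -/(cabs _).
move: fe; rewrite ltr_pdivlMr //; have := nr_ge0 (m f x - u); lra.
Qed.

Lemma Delta_self x : Delta m x x.
Proof.
apply/DeltaP => e e0; exists 1; last by rewrite ck_act1 subrr nr0.
by move=> t; rewrite cfun1E /cabs normr1.
Qed.

Lemma Delta0 x : Delta m x 0.
Proof.
apply/DeltaP => e e0; exists 0; last by rewrite act0 subrr nr0.
by move=> t; rewrite cfun0E /cabs normr0 ler01.
Qed.

Lemma Delta_cyclic x u : Delta m x u -> cyclic m x u.
Proof.
move=> /DeltaP H; apply/cyclicP => e /H [f _ fe]; by exists f.
Qed.

Lemma unitcE (c : R[i]) : 0 <= c <= 1 ->
  [/\ 0 <= complex.Re c, complex.Re c <= 1 & c = (complex.Re c)%:C].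
Proof.
rewrite !lecE; case: c => a b /= /andP[/andP[/eqP -> a0] /andP[_ a1]].
by split.
Qed.

Lemma cabs_unitc (c : R[i]) : 0 <= c <= 1 -> cabs c <= 1 /\ cabs (1 - c) <= 1.
Proof.
move=> /unitcE[c0 c1 ->]; rewrite -(rmorph1 (real_complex R)) -rmorphB /=.
rewrite !cabs_real !ger0_norm ?subr_ge0 //; split=> //; lra.
Qed.

(** Symmetric in substance: replacing [h] by [1 - h] exchanges [u] and [v]. *)
Definition sep u v := forall e : R, 0 < e -> exists h : Cfun R K,
  [/\ forall t, 0 <= h t <= 1, nr (u - m h u) < e & nr (m h v) < e].

(** Used pointwise to glue two multipliers [f] and [g] of the unit ball into [f * h + g * (1 - h)],
    again in the unit ball. *)
Lemma unitc_convex (p c d : R[i]) : 0 <= p <= 1 -> cabs c <= 1 -> cabs d <= 1 ->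
  cabs (c * p + d * (1 - p)) <= 1.
Proof.
move=> /unitcE[p0 p1 ->]; rewrite -(rmorph1 (real_complex R)) -rmorphB => c1 d1.
apply: le_trans (cabsD _ _) _; rewrite !cabsM !cabs_real !ger0_norm ?subr_ge0 //.
move: (cabs c) (cabs d) c1 d1 => a b; nra.
Qed.

(** A separating [h] nearly fixes [u] and nearly kills [v], so [f u] is close to [h f (u + v)], and
    [h] is a contraction. *)
Lemma sep_act_le u v f : sep u v -> nr (m f u) <= nr (m f (u + v)).
Proof.
move=> uv; have [M M0 fM] := cfun_bounded Kc f.
apply/ler_addgt0Pl => e e0.
have e2 : 0 < e / (2 * M) by rewrite divr_gt0 // mulr_gt0.
have [h [h01 hu hv]] := uv _ e2.
have h1 : forall t, cabs (h t) <= 1 by move=> t; have [] := cabs_unitc (h01 t).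
have E0 : m f u = m h (m f (u + v)) + (m f (u - m h u) - m f (m h v)).
  by rewrite -ck_actM mulrC; module_eq X.
have F x : nr x < e / (2 * M) -> nr (m f x) <= e / 2.
  move=> xe; apply: le_trans (act_le m x (ltW M0) fM) _.
  apply: le_trans (ler_wpM2l (ltW M0) (ltW xe)) _.
  by rewrite le_eqVlt; apply/orP; left; apply/eqP; field; rewrite gt_eqF.
have := F _ hu; have := F _ hv; have := act_le1 m (m f (u + v)) h1.
have := nrD (m h (m f (u + v))) (m f (u - m h u) - m f (m h v)).
have := nrD (m f (u - m h u)) (- m f (m h v)).
rewrite nrN -E0; lra.
Qed.

End Separation.

(** * Equivalence of module disjointness and approximate separation *)

Section Disjoint.
Context {R : realType} {K : topologicalType} {X : completeNormedModType R[i]}.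
Variables (Kc : compact [set: K]) (m : ck_module K X).
Implicit Types (f g h k : Cfun R K) (x y z u v w : X).

Lemma sep_disjoint x y : sep m x y -> ck_disjoint m x y.
Proof.
move=> xy; split; apply/seteqP; split=> w /=.
- move=> /(DeltaP Kc) wP.
  (* By [sep_act_le], multipliers that bring [x + y] near [w] bring [x] near a common limit [u], and
     then [y] near [w - u]. *)
  have ext (i j : {f : Cfun R K | forall t, cabs (f t) <= 1}) :
      nr (m (sval i) x - m (sval j) x) <=
      nr (m (sval i) (x + y) - w) + nr (m (sval j) (x + y) - w).
    rewrite -actB; apply: le_trans (sep_act_le Kc _ xy) _.
    by rewrite actB [nr (m (sval j) _ - w)]nrB nr_tri.
  have [|u uP] := complete_ext ext.
    by move=> e /wP [f f1 fe]; exists (exist _ f f1).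
  exists u.
    apply/(DeltaP Kc) => e /wP [f f1 fe]; exists f => //.
    exact: le_lt_trans (uP (exist _ f f1)) fe.
  exists (w - u); last by rewrite addrC subrK.
  apply/(DeltaP Kc) => e e0.
  have [|f f1 fe] := wP (e / 2); first by rewrite divr_gt0.
  exists f => //.
  have -> : m f y - (w - u) = (m f (x + y) - w) - (m f x - u) by module_eq X.
  have := nrD (m f (x + y) - w) (- (m f x - u)); rewrite nrN.
  by have /= := uP (exist _ f f1); lra.
- case=> u /(DeltaP Kc) uP [v /(DeltaP Kc) vP <-].
  apply/(DeltaP Kc) => e e0.
  have e6 : 0 < e / 6 by rewrite divr_gt0.
  have [f f1 fe] := uP _ e6; have [g g1 ge] := vP _ e6.
  have [h [h01 hx hy]] := xy _ e6.
  (* Acts nearly as [f] on [x] and as [g] on [y]. *)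
  exists (f * h + g * (1 - h)).
    by move=> t; rewrite !cfunDE !cfunME cfunDE cfunNE; exact: unitc_convex.
  have -> : m (f * h + g * (1 - h)) (x + y) - (u + v) =
      ((m f x - u) + (m g y - v)) + (m f (m h y) - m f (x - m h x))
       + (m g (x - m h x) - m g (m h y)) by module_eq X.
  apply: le_lt_trans (nrD3 _ _ _) _.
  have := nrD (m f x - u) (m g y - v).
  have := nrD (m f (m h y)) (- m f (x - m h x)).
  have := nrD (m g (x - m h x)) (- m g (m h y)).
  have := act_le1 m (x - m h x) f1; have := act_le1 m (m h y) f1.
  have := act_le1 m (x - m h x) g1; have := act_le1 m (m h y) g1.
  rewrite !nrN; lra.
- case=> /(DeltaP Kc) wx /(DeltaP Kc) wy; apply: nr_small_eq0 => e e0.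
  have e6 : 0 < e / 6 by rewrite divr_gt0.
  have [f f1 fe] := wx _ e6; have [g g1 ge] := wy _ e6.
  have [h [h01 hx hy]] := xy _ e6.
  have h1 t : cabs (h t) <= 1 by have [] := cabs_unitc (h01 t).
  (* [h] nearly fixes [w], which is close to [f x], and nearly kills it, as it is also close to
     [g y]; the identity collects the errors. *)
  have E : w = (m h (m f x - w) - (m f x - w)) - (m h (m g y - w) - m g (m h y))
      + m f (x - m h x).
    by rewrite !act_addx -!ck_actM [h * f]mulrC [h * g]mulrC; module_eq X.
  rewrite [in nr w]E; apply: le_trans (nrD3 _ _ _) _.
  have := nrD (m h (m f x - w)) (- (m f x - w)).
  have := nrD (m h (m g y - w)) (- m g (m h y)).
  have := act_le1 m (m f x - w) h1; have := act_le1 m (m g y - w) h1.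
  have := act_le1 m (x - m h x) f1; have := act_le1 m (m h y) g1.
  rewrite !nrN; lra.
- by move->; split; exact: Delta0.
Qed.

Lemma minfun_subproof f g :
  continuous (fun t => Num.min (cabs (f t)) (cabs (g t))).
Proof.
by move=> t; apply: (@continuous_min R K (cabs \o f) (cabs \o g)); exact: cabs_cont.
Qed.

Definition absfun f : Cfun R K := rfun (@cabs_cont R K f).
Definition minfun f g : Cfun R K := rfun (@minfun_subproof f g).

Lemma minfunE f g t : minfun f g t = (Num.min (cabs (f t)) (cabs (g t)))%:C.
Proof. by []. Qed.

Lemma cabs_minfun f g t :
  cabs (minfun f g t) = Num.min (cabs (f t)) (cabs (g t)).
Proof. by rewrite cabs_real ger0_norm // le_min !cabs_ge0. Qed.

Lemma act_abs f x : nr (m (absfun f) x) = nr (m f x).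
Proof.
have E t : cabs (absfun f t) = cabs (f t).
  by rewrite cabs_real ger0_norm ?cabs_ge0.
by apply/eqP; rewrite eq_le !act_dom // => t; rewrite E.
Qed.

(** Passing to moduli keeps the norms and turns the right-hand side into one dominating function
    [|f| + |g|]. *)
Lemma act_dom2 k f g x : (forall t, cabs (k t) <= cabs (f t) + cabs (g t)) ->
  nr (m k x) <= nr (m f x) + nr (m g x).
Proof.
move=> kfg; rewrite -(act_abs f) -(act_abs g).
apply: le_trans (nrD _ _); rewrite -ck_actD; apply: act_dom => t.
by rewrite cfunDE /= -rmorphD cabs_real ger0_norm ?addr_ge0 ?cabs_ge0.
Qed.

Lemma min_lip (a b c d : R) :
  `|Num.min a b - Num.min c d| <= `|a - c| + `|b - d|.
Proof.
rewrite !minEle; case: (leP a b); case: (leP c d) => H1 H2;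
  rewrite ler_norml; have := ler_norm (a - c); have := ler_norm (b - d);
  have := ler_norm (- (a - c)); have := ler_norm (- (b - d));
  rewrite !normrN; lra.
Qed.

(** [w] plays the role of [|u| /\ |v|]: the minimum is Lipschitz, so [min(|f|, |g|) z] converges as
    [f z] tends to [u] and [g z] to [v]. *)
Lemma meet_exists z u v : cyclic m z u -> cyclic m z v ->
  exists w, forall f g,
    nr (m (minfun f g) z - w) <= nr (m f z - u) + nr (m g z - v).
Proof.
move=> /cyclicP zu /cyclicP zv.
have [] := @complete_ext R (Cfun R K * Cfun R K) X
  (fun i => m (minfun i.1 i.2) z)
  (fun i => nr (m i.1 z - u) + nr (m i.2 z - v)).
- move=> [f g] [f' g'] /=; rewrite -actB.
  apply: le_trans (@act_dom2 _ (f - f') (g - g') z _) _.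
    move=> t; rewrite !cfunDE !cfunNE /= -rmorphB cabs_real.
    apply: le_trans (min_lip _ _ _ _) _.
    by apply: lerD; exact: cabs_lip.
  rewrite !actB; have := nr_tri u (m f z) (m f' z).
  have := nr_tri v (m g z) (m g' z).
  rewrite [nr (u - _)]nrB [nr (v - _)]nrB; lra.
- move=> e e0; have e2 : 0 < e / 2 by rewrite divr_gt0.
  have [f fe] := zu _ e2; have [g ge] := zv _ e2.
  by exists (f, g) => /=; lra.
by move=> w wP; exists w => f g; exact: (wP (f, g)).
Qed.

(* The limit of the elements min(|f|, |g|) z is |u| /\ |v|; when it is 0, the
   functions |f| / (|f| + |g| + eta) separate u from v. *)
Lemma meet0_sep z u v : cyclic m z u -> cyclic m z v ->
  (forall f g, nr (m (minfun f g) z) <= nr (m f z - u) + nr (m g z - v)) ->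
  sep m u v.
Proof.
move=> /cyclicP zu /cyclicP zv mP e e0.
have e4 : 0 < e / 5 by rewrite divr_gt0.
have [f fe] := zu _ e4; have [g ge] := zv _ e4.
have z1 : 0 < nr z + 1 by rewrite ltr_wpDl ?nr_ge0.
pose eta := e / 5 / (nr z + 1).
have eta0 : 0 < eta by rewrite divr_gt0.
have etaz : eta * nr z <= e / 5.
  by rewrite /eta mulrAC ler_pdivrMr // ler_pM2l // lerDl.
pose D t := cabs (f t) + cabs (g t) + eta.
have D0 t : 0 < D t by rewrite ltr_wpDl ?addr_ge0 ?cabs_ge0.
pose r t := cabs (f t) / D t.
have rc : continuous r.
  move=> t; apply: cvgM; first exact: cabs_cont.
  apply: cvgV; first by rewrite gt_eqF.
  apply: cvgD; last exact: cvg_cst.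
  by apply: cvgD; exact: cabs_cont.
have r0 t : 0 <= r t by rewrite divr_ge0 ?cabs_ge0 // ltW.
have r1 t : r t <= 1.
  rewrite ler_pdivrMr // mul1r /D -addrA lerDl.
  by rewrite addr_ge0 ?cabs_ge0 // ltW.
exists (rfun rc); split.
- by move=> t; rewrite !lecE /= !eqxx r0 r1.
- have h1 t : cabs ((1 - rfun rc) t) <= 1.
    rewrite cfunDE cfunNE cfun1E -(rmorph1 (real_complex R)) -rmorphB cabs_real.
    by rewrite ger0_norm ?subr_ge0 // gerBl.
  have -> : u - m (rfun rc) u =
      m ((1 - rfun rc) * f) z - m (1 - rfun rc) (m f z - u) by module_eq X.
  have := nrD (m ((1 - rfun rc) * f) z) (- m (1 - rfun rc) (m f z - u)).
  rewrite nrN; have := act_le1 m (m f z - u) h1.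
  have := @act_dom2 ((1 - rfun rc) * f) (minfun f g) (eta%:C *: (1 : Cfun R K)) z.
  rewrite ck_actZ ck_act1 nrZ -/(cabs _) cabs_real (ger0_norm (ltW eta0)).
  (* [(1 - r) |f| = |f| (|g| + eta) / D], where [|f| |g| / D] is at most the minimum and
     [|f| eta / D] at most [eta]. *)
  have dom t : cabs (((1 - rfun rc) * f) t) <=
      cabs (minfun f g t) + cabs ((eta%:C *: (1 : Cfun R K)) t).
    rewrite cabs_minfun cfunZE cfun1E mulr1 cabs_real (ger0_norm (ltW eta0)).
    rewrite cfunME cabsM cfunDE cfunNE cfun1E -(rmorph1 (real_complex R)).
    rewrite -rmorphB cabs_real ger0_norm ?subr_ge0 //.
    have -> : 1 - r t = (cabs (g t) + eta) / D t.
      have Dn : D t != 0 by rewrite gt_eqF.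
      rewrite -(divff Dn) -mulrBl; congr (_ / _).
      by rewrite /D; lra.
    rewrite mulrAC ler_pdivrMr // /D.
    move: (cabs (f t)) (cabs (g t)) (cabs_ge0 (f t)) (cabs_ge0 (g t)) => a b a0 b0.
    by rewrite minEle; case: ifP => _; nra.
  move=> /(_ dom); have := mP f g; lra.
- have h1 t : cabs (rfun rc t) <= 1 by rewrite cabs_real ger0_norm.
  have -> : m (rfun rc) v = m (rfun rc * g) z - m (rfun rc) (m g z - v)
    by module_eq X.
  have := nrD (m (rfun rc * g) z) (- m (rfun rc) (m g z - v)).
  rewrite nrN; have := act_le1 m (m g z - v) h1.
  (* [r |g| = |f| |g| / D] lies below both [|f|] and [|g|]. *)
  have : nr (m (rfun rc * g) z) <= nr (m (minfun f g) z).
    apply: act_dom => t; rewrite cfunME cabsM cabs_real ger0_norm // cabs_minfun.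
    rewrite le_min; apply/andP; split; last by rewrite ler_piMl ?cabs_ge0.
    rewrite /r mulrAC ler_pdivrMr // ler_wpM2l ?cabs_ge0 // /D.
    by have := cabs_ge0 (f t); lra.
  have := mP f g; lra.
Qed.

(** The identity for [Delta (x + y)] puts [x] and [y] in the cyclic subspace of [x + y], where
    [w = |x| /\ |y|] exists. This [w] lies in [Delta x] and in [Delta y], hence vanishes. *)
Lemma disjoint_sep x y : ck_disjoint m x y -> sep m x y.
Proof.
move=> [Dxy Dx0]; set z := x + y in Dxy.
have zx : cyclic m z x.
  apply: (Delta_cyclic Kc); rewrite Dxy.
  by exists x; [exact: Delta_self|exists 0; [exact: Delta0|rewrite addr0]].
have zy : cyclic m z y.
  apply: (Delta_cyclic Kc); rewrite Dxy.
  by exists 0; [exact: Delta0|exists y; [exact: Delta_self|rewrite add0r]].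
have [w wP] := meet_exists zx zy.
suff w0 : w = 0 by apply: (meet0_sep zx zy) => f g; have := wP f g; rewrite w0 subr0.
suff : [set 0] w by [].
rewrite -Dx0.
(* A function [k] dominated by [f] is nearly [h f] with [|h| <= 1], so [w] is close to [h u]. *)
have main u v f g k : (forall t, cabs (k t) <= cabs (f t)) -> forall e, 0 < e ->
    nr (m k z - w) < e / 5 -> nr (m f z - u) < e / 5 ->
    exists2 h : Cfun R K, (forall t, cabs (h t) <= 1) & nr (m h u - w) < e.
  move=> kf e e0 kw fu.
  have e5 : 0 < e / 5 by rewrite divr_gt0.
  have z1 : 0 < nr z + 1 by rewrite ltr_wpDl ?nr_ge0.
  pose eta := e / 5 / (nr z + 1).
  have eta0 : 0 < eta by rewrite divr_gt0.
  have etaz : eta * nr z <= e / 5.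
    by rewrite /eta mulrAC ler_pdivrMr // ler_pM2l // lerDl.
  have [h [h1 hk]] := approx_factor eta0 kf.
  exists h => //.
  have -> : m h u - w = (m k z - w) - m (k - h * f) z - m h (m f z - u)
    by module_eq X.
  apply: le_lt_trans (nrD3 _ _ _) _; rewrite !nrN.
  have := act_le1 m (m f z - u) h1; have := act_le m z (ltW eta0) hk; lra.
split; apply/(DeltaP Kc) => e e0; have e10 : 0 < e / 10 by rewrite divr_gt0.
- have [f fe] := (cyclicP m z x).1 zx _ e10.
  have [g ge] := (cyclicP m z y).1 zy _ e10.
  apply: (main x y f g (minfun f g)) => //.
  + by move=> t; rewrite cabs_minfun ge_min lexx.
  + by have := wP f g; lra.
  + lra.
- have [f fe] := (cyclicP m z x).1 zx _ e10.
  have [g ge] := (cyclicP m z y).1 zy _ e10.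
  apply: (main y x g f (minfun f g)) => //.
  + by move=> t; rewrite cabs_minfun ge_min lexx orbT.
  + by have := wP f g; lra.
  + lra.
Qed.

Lemma disjointP x y : ck_disjoint m x y <-> sep m x y.
Proof. by split; [exact: disjoint_sep|exact: sep_disjoint]. Qed.

End Disjoint.

(** * Disjointness in the Banach lattice of a cyclic subspace *)

Section Angles.
Context {R : realType}.

Lemma cos_ge (x : R) : 1 - `|x| <= cos x.
Proof.
wlog x0 : x / 0 <= x => [W|].
  have [/W//|/ltW x0] := leP 0 x.
  by rewrite -cosN -normrN W // oppr_ge0.
have [c _] := MVT_segment x0 (fun t _ => is_derive_cos t)
  (continuous_subspaceT (@continuous_cos R)).
rewrite cos0 subr0 ger0_norm // => E.
have : - sin c * x >= - x.
  by rewrite mulNr lerN2 ler_piMl // sin_le1.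
lra.
Qed.

Lemma polar (a b : R) : exists2 th, `|th| <= pi &
  a = Num.sqrt (a ^+ 2 + b ^+ 2) * cos th /\
  b = Num.sqrt (a ^+ 2 + b ^+ 2) * sin th.
Proof.
set r := Num.sqrt _.
have r2 : r ^+ 2 = a ^+ 2 + b ^+ 2.
  by rewrite sqr_sqrtr // addr_ge0 // sqr_ge0.
have r0 : 0 <= r by rewrite sqrtr_ge0.
have [r00|rn0] := eqVneq r 0.
  move: r2; rewrite r00 expr0n /= => /esym/eqP.
  rewrite paddr_eq0 ?sqr_ge0 // !sqrf_eq0 => /andP[/eqP -> /eqP ->].
  by exists 0; rewrite ?normr0 ?pi_ge0 // !mul0r.
have rp : 0 < r by rewrite lt_neqAle eq_sym rn0.
have ar : -1 <= a / r <= 1.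
  rewrite -ler_norml normrM normfV (ger0_norm r0) ler_pdivrMr // mul1r.
  by rewrite -sqrtr_sqr ler_wsqrtr // lerDl sqr_ge0.
have [/andP[t0 t1] ct] := acos_def ar.
have st : sin (acos (a / r)) = `|b| / r.
  rewrite sin_acos // -sqrtr_sqr -[r in RHS]ger0_norm // -(sqrtr_sqr r).
  rewrite -sqrtrV ?sqr_ge0 // -sqrtrM ?sqr_ge0 //; congr Num.sqrt.
  by rewrite expr_div_n r2; field; rewrite -r2 sqrf_eq0.
(* [acos] only reaches the upper half-plane; the sign of [b] selects the half. *)
exists (if 0 <= b then acos (a / r) else - acos (a / r)).
  by case: ifP => _; rewrite ?normrN ger0_norm.
have -> : cos (if 0 <= b then acos (a / r) else - acos (a / r)) = a / r.
  by case: ifP; rewrite ?cosN ct.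
have -> : sin (if 0 <= b then acos (a / r) else - acos (a / r)) = b / r.
  case: ifP => b0; rewrite ?sinN st; first by rewrite ger0_norm.
  by rewrite ltr0_norm ?mulNr ?opprK // ltNge b0.
by split; rewrite mulrC divfK.
Qed.

(** The polar angle lies within [d] of a grid of step [d], and the cosine of the difference is at
    least [1 - d]. *)
Lemma finite_angles (d : R) : 0 < d -> exists s : seq R, forall a b : R,
  exists2 t, t \in s &
    Num.sqrt (a ^+ 2 + b ^+ 2) * (1 - d) <= cos t * a + sin t * b.
Proof.
move=> d0; pose N := Num.truncn ((pi : R) / d).
pose s0 := [seq j%:R * d | j <- iota 0 N.+1].
exists (s0 ++ [seq - t | t <- s0]) => a b.
have [th thpi [Ea Eb]] := polar a b; set r := Num.sqrt _ in Ea Eb *.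
have dth : 0 <= `|th| / d by rewrite divr_ge0 // ltW.
pose j := Num.truncn (`|th| / d).
have jN : j%:R * d \in s0.
  apply/mapP; exists j => //; rewrite mem_iota add0n ltnS.
  by apply: le_truncn; rewrite ler_pM2r ?invr_gt0.
have /andP[j1 j2] : j%:R <= `|th| / d < j.+1%:R by exact: truncn_itv.
rewrite ler_pdivlMr // in j1; rewrite ltr_pdivrMr // in j2.
have close t : `|th - t| <= d -> r * (1 - d) <= cos t * a + sin t * b.
  move=> tht; rewrite Ea Eb !(mulrCA _ r) -mulrDr -/r.
  rewrite mulrC [cos t * _]mulrC [sin t * _]mulrC -cosB.
  rewrite [_ * r]mulrC ler_wpM2l ?sqrtr_ge0 //.
  by apply: le_trans (cos_ge _); rewrite lerD2l lerN2.
have [th0|th0] := leP 0 th.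
  exists (j%:R * d); first by rewrite mem_cat jN.
  apply: close; move: j1 j2; rewrite (ger0_norm th0) -natr1 => j1 j2.
  by rewrite ger0_norm; lra.
exists (- (j%:R * d)); first by rewrite mem_cat map_f ?orbT.
apply: close; move: j1 j2; rewrite (ltr0_norm th0) -natr1 => j1 j2.
by rewrite opprK ler0_norm; lra.
Qed.

End Angles.

(** * The positive cone and least upper bounds in a cyclic subspace *)

Section Lattice.
Context {R : realType} {K : topologicalType} {X : completeNormedModType R[i]}.
Variable m : ck_module K X.
Implicit Types (f g h k : Cfun R K) (x y z u v w : X).

Lemma nnegcE (c : R[i]) : 0 <= c -> 0 <= complex.Re c /\ c = (complex.Re c)%:C.
Proof. by rewrite lecE; case: c => a b /= /andP[/eqP ->]. Qed.

Lemma realc_ge0 (r : R) : 0 <= r -> 0 <= r%:C.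
Proof. by rewrite -lecR. Qed.

Lemma cone0 z : cyclic_cone m z 0.
Proof.
apply/coneP => e e0; exists 0; last by rewrite act0 subrr nr0.
by move=> t; rewrite cfun0E.
Qed.

Lemma coneZ z u (c : R) : 0 < c -> cyclic_cone m z u ->
  cyclic_cone m z (c%:C *: u).
Proof.
move=> c0 /coneP uP; apply/coneP => e e0.
have [|f f0 fe] := uP (e / c); first by rewrite divr_gt0.
exists (c%:C *: f) => [t|].
  by rewrite cfunZE mulr_ge0 // realc_ge0 // ltW.
rewrite ck_actZ -scalerBr nrZ -/(cabs _) cabs_real gtr0_norm //.
by rewrite mulrC -ltr_pdivlMr.
Qed.

(** For nonnegative functions [f <= f + g], while [(f + g) z] is close to [u - u = 0]. *)
Lemma cone_anti z u : cyclic_cone m z u -> cyclic_cone m z (- u) -> u = 0.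
Proof.
move=> /coneP uP /coneP vP; apply: nr_small_eq0 => e e0.
have e3 : 0 < e / 3 by rewrite divr_gt0.
have [f f0 fe] := uP _ e3; have [g g0 ge] := vP _ e3.
have fg : nr (m f z) <= nr (m (f + g) z).
  apply: act_dom => t; rewrite cfunDE.
  have [a0 ->] := nnegcE (f0 t); have [b0 ->] := nnegcE (g0 t).
  by rewrite -rmorphD !cabs_real !ger0_norm ?addr_ge0 // lerDl.
have E : u = m f z - (m f z - u) by module_eq X.
have E2 : m (f + g) z = (m f z - u) + (m g z - - u) by module_eq X.
have := nrD (m f z) (- (m f z - u)); rewrite -E nrN.
by have := nrD (m f z - u) (m g z - - u); rewrite -E2; lra.
Qed.

Lemma cone_real_part z u : cyclic_cone m z u -> real_part (cyclic_cone m z) u.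
Proof. by move=> uP; exists u => //; exists 0; [exact: cone0|rewrite subr0]. Qed.

(** Extends pointwise Lipschitz operations (modulus, real and imaginary part) by continuity to the
    cyclic subspace. *)
Lemma lip_ext (F : Cfun R K -> Cfun R K) z u :
  (forall f g t, cabs (F f t - F g t) <= cabs (f t - g t)) ->
  cyclic m z u ->
  exists L, forall f, nr (m (F f) z - L) <= nr (m f z - u).
Proof.
move=> Flip /cyclicP zu.
apply: (@complete_ext R _ X (fun f => m (F f) z)) => // f g.
rewrite -actB; apply: le_trans (@act_dom _ _ _ m _ (f - g) z _) _.
  by move=> t; exact: Flip.
by rewrite actB [nr (m g z - u)]nrB nr_tri.
Qed.

Definition Refun f : Cfun R K := rfun (@Re_cont R K f).
Definition Imfun f : Cfun R K := rfun (@Im_cont R K f).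

Lemma Re_Im_fun f : f = Refun f + 'i *: Imfun f.
Proof.
apply/continuousEP => t; rewrite cfunDE cfunZE /=.
by case: (f t) => a b; simpc.
Qed.

Lemma ReB (c d : R[i]) : complex.Re (c - d) = complex.Re c - complex.Re d.
Proof. exact: raddfB. Qed.

Lemma ImB (c d : R[i]) : complex.Im (c - d) = complex.Im c - complex.Im d.
Proof. exact: raddfB. Qed.

Lemma nrZr (c : R) w : nr (c%:C *: w) = `|c| * nr w.
Proof. by rewrite nrZ -/(cabs _) cabs_real. Qed.

Lemma nrZi w : nr ('i *: w : X) = nr w.
Proof. by rewrite nrZ -/(cabs _) cabs_sqrt /= expr0n expr1n add0r sqrtr1 mul1r. Qed.

Lemma real_part_approx z c e : real_part (cyclic_cone m z) c -> 0 < e ->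
  exists2 r : Cfun R K, (forall t, r t = (complex.Re (r t))%:C) &
    nr (m r z - c) < e.
Proof.
move=> [p /coneP pP [q /coneP qP <-]] e0.
have e2 : 0 < e / 2 by rewrite divr_gt0.
have [f f0 fe] := pP _ e2; have [g g0 ge] := qP _ e2.
exists (f - g) => [t|].
  have [_ Ef] := nnegcE (f0 t); have [_ Eg] := nnegcE (g0 t).
  by rewrite cfunDE cfunNE Ef Eg -rmorphB.
have -> : m (f - g) z - (p - q) = (m f z - p) - (m g z - q) by module_eq X.
by have := nrD (m f z - p) (- (m g z - q)); rewrite nrN; lra.
Qed.

(* Up to a factor 1 - d, |f| is a maximum over finitely many angles; the error
   term E accumulates the deviations from positivity at each of them. *)
Lemma modulus_lub z a b p (c : X) : 
  (forall e, 0 < e -> exists f, [/\ nr (m (Refun f) z - a) < e,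
    nr (m (Imfun f) z - b) < e & nr (m (absfun f) z - p) < e]) ->
  real_part (cyclic_cone m z) c ->
  (forall t : R, cyclic_cone m z (c - ((cos t)%:C *: a + (sin t)%:C *: b))) ->
  cyclic_cone m z (c - p).
Proof.
move=> abp cR cP; apply/coneP => e e0.
(* [|f| z] will have norm at most [nr p + e], so the term [d |f| z] costs at most [e / 4]. *)
pose d := e / 4 / (nr p + e).
have pe : 0 < nr p + e by rewrite ltr_wpDl ?nr_ge0.
have d0 : 0 < d by rewrite !divr_gt0.
have dp : d * (nr p + e) = e / 4 by rewrite divfK // gt_eqF.
have [s sP] := finite_angles d0.
pose n := size s; pose eta := e / (8 * n.+1%:R).
have n0 : 0 < 8 * n.+1%:R :> R by rewrite mulr_gt0.
have eta0 : 0 < eta by rewrite divr_gt0.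
have etan : eta * (8 * n.+1%:R) = e by rewrite divfK // gt_eqF.
have [f [fa fb fp]] := abp _ eta0.
have [r rR rc] := real_part_approx cR eta0.
have bound : exists E : Cfun R K, [/\ forall t, 0 <= E t,
    nr (m E z) <= eta * (4 * n%:R) & forall th, th \in s -> forall t,
    0 <= complex.Re (r t) - (cos th * complex.Re (f t) + sin th * complex.Im (f t))
         + complex.Re (E t)].
  rewrite /n; elim: (s) => [|th s' [E [E0 Ez EP]]].
    exists 0; split => //; last by rewrite act0 nr0 mulr0 mulr0.
  have /coneP/(_ _ eta0)[q q0 qe] := cP th.
  (* [r - (cos th Re f + sin th Im f) = q + D] with [q >= 0], so adding [|D|] to the error restores
     positivity at [th]. *)
  pose D := r - ((cos th)%:C *: Refun f + (sin th)%:C *: Imfun f) - q.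
  have Dz : nr (m D z) <= eta * 4.
    have -> : m D z = (m r z - c) - (m q z - (c - ((cos th)%:C *: a + (sin th)%:C *: b)))
        - ((cos th)%:C *: (m (Refun f) z - a)) - ((sin th)%:C *: (m (Imfun f) z - b)).
      by rewrite /D; module_eq X.
    apply: le_trans (nrD4 _ _ _ _) _; rewrite !nrN !nrZr.
    have A1 : `|cos th| * nr (m (Refun f) z - a) <= eta.
      apply: le_trans (ltW fa); rewrite ler_piMl ?nr_ge0 //.
      by rewrite ler_norml cos_geN1 cos_le1.
    have A2 : `|sin th| * nr (m (Imfun f) z - b) <= eta.
      apply: le_trans (ltW fb); rewrite ler_piMl ?nr_ge0 //.
      by rewrite ler_norml sin_geN1 sin_le1.
    lra.
  exists (E + absfun D); split.
  - by move=> t; rewrite cfunDE addr_ge0 // realc_ge0 ?cabs_ge0.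
  - rewrite ck_actD; apply: le_trans (nrD _ _) _; rewrite act_abs.
    by rewrite /= -[(size s').+1%:R]natr1 !mulrDr mulr1 lerD.
  - move=> th'; rewrite inE => /predU1P[->|th's] t; last first.
      have := EP _ th's t; rewrite cfunDE raddfD /=.
      by have := cabs_ge0 (D t); lra.
    rewrite cfunDE raddfD /=.
    have [Et _] := nnegcE (E0 t); have [qt _] := nnegcE (q0 t).
    have ED : complex.Re (D t) = complex.Re (r t) -
        (cos th * complex.Re (f t) + sin th * complex.Im (f t)) - complex.Re (q t).
      rewrite /D !cfunDE !cfunNE !cfunDE !cfunZE /= -!rmorphM -rmorphD.
      by rewrite !ReB.
    have := cabs_Re (D t); rewrite ler_norml ED => /andP[+ _]; lra.
have [E [E0 Ez EP]] := bound.
(* At each point some angle of [s] gives [r + E >= (1 - d) |f|]; the last term makes up for the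
   factor [1 - d]. *)
exists (r - absfun f + E + d%:C *: absfun f) => [t|].
  rewrite !cfunDE cfunNE cfunZE /= rR.
  have [_ ->] := nnegcE (E0 t).
  rewrite -rmorphM -rmorphB -!rmorphD realc_ge0 //.
  have [th ths] := sP (complex.Re (f t)) (complex.Im (f t)).
  by rewrite -cabs_sqrt; have := EP th ths t; lra.
have -> : m (r - absfun f + E + d%:C *: absfun f) z - (c - p) =
   (m r z - c) - (m (absfun f) z - p) + m E z + d%:C *: m (absfun f) z.
  by module_eq X.
apply: le_lt_trans (nrD4 _ _ _ _) _; rewrite nrN nrZr gtr0_norm //.
have fpe : nr (m (absfun f) z) <= nr p + e.
  have -> : m (absfun f) z = p + (m (absfun f) z - p) by abel_at X.
  apply: le_trans (nrD _ _) _; rewrite lerD2l; apply: le_trans (ltW fp) _.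
  rewrite -etan ler_peMr // ?ltW //.
  by have : 1 <= n.+1%:R :> R; [rewrite ler1n|lra].
have := ler_wpM2l (ltW d0) fpe; rewrite dp.
have n1 : n.+1%:R = n%:R + 1 :> R by rewrite natr1.
rewrite n1 in etan.
have : 0 <= eta * n%:R by rewrite mulr_ge0 // ltW.
lra.
Qed.

End Lattice.

(** * Moduli, and lattice disjointness as approximate separation *)

Section LatticeDisjoint.
Context {R : realType} {K : topologicalType} {X : completeNormedModType R[i]}.
Variable m : ck_module K X.
Implicit Types (f g h k : Cfun R K) (x y z u v w : X).

Lemma two_halves w : (2^-1 : R)%:C *: (w + w) = w.
Proof.
rewrite -[w + w]mulr2n -[w *+ 2]scaler_nat scalerA.
rewrite -(rmorph_nat (real_complex R)) -rmorphM.
by rewrite mulVf ?pnatr_eq0 // scale1r.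
Qed.

Lemma nr_double w : nr (w + w) = 2 * nr w.
Proof.
rewrite -[w + w]mulr2n -[w *+ 2]scaler_nat -(rmorph_nat (real_complex R)) nrZr.
by rewrite ger0_norm.
Qed.

(** Cauchy-Schwarz, by way of Lagrange's identity. *)
Lemma cos_sin_le (t a b : R) : cos t * a + sin t * b <= Num.sqrt (a ^+ 2 + b ^+ 2).
Proof.
apply: le_trans (ler_norm _) _; rewrite -sqrtr_sqr ler_wsqrtr //.
have := sqr_ge0 (cos t * b - sin t * a).
have -> : a ^+ 2 + b ^+ 2 = (cos t ^+ 2 + sin t ^+ 2) * (a ^+ 2 + b ^+ 2).
  by rewrite cos2Dsin2 mul1r.
by lra.
Qed.

(** The estimate accompanying [p] records that [|f| z] approximates the modulus at least as well as
    [f z] approximates [u]. *)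
Lemma modulus_exists z u : cyclic m z u ->
  exists p, is_modulus (cyclic_cone m z) u p /\
    forall f, nr (m (absfun f) z - p) <= nr (m f z - u).
Proof.
move=> zu.
have [p pP] : exists p, forall f, nr (m (absfun f) z - p) <= nr (m f z - u).
  apply: lip_ext zu => // f g t; rewrite /= -rmorphB cabs_real; exact: cabs_lip.
have [a aP] : exists a, forall f, nr (m (Refun f) z - a) <= nr (m f z - u).
  apply: lip_ext zu => // f g t; rewrite /= -rmorphB cabs_real -ReB; exact: cabs_Re.
have [b bP] : exists b, forall f, nr (m (Imfun f) z - b) <= nr (m f z - u).
  apply: lip_ext zu => // f g t; rewrite /= -rmorphB cabs_real -ImB; exact: cabs_Im.
move/cyclicP : zu => zu.
have rp (F : Cfun R K -> Cfun R K) c :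
    (forall f, nr (m (F f) z - c) <= nr (m f z - u)) ->
    (forall f t, exists2 r : R, F f t = r%:C & `|r| <= cabs (f t)) ->
    real_part (cyclic_cone m z) c.
  move=> cP Fr.
  (* [c] is the difference of [(p + c) / 2] and [(p - c) / 2], both in the cone because
     [|F f| <= |f|]. *)
  exists ((2^-1 : R)%:C *: (p + c)); [|exists ((2^-1 : R)%:C *: (p - c))].
  - apply: coneZ; first by rewrite invr_gt0.
    apply/coneP => e e0; have [|f fe] := zu (e / 2); first by rewrite divr_gt0.
    exists (absfun f + F f).
      move=> t; have [r Er rf] := Fr f t; rewrite cfunDE Er -rmorphD realc_ge0 //.
      by have := ler_norm (- r); rewrite normrN /=; lra.
    have -> : m (absfun f + F f) z - (p + c) =
      (m (absfun f) z - p) + (m (F f) z - c) by module_eq X.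
    apply: le_lt_trans (nrD _ _) _; have := pP f; have := cP f; lra.
  - apply: coneZ; first by rewrite invr_gt0.
    apply/coneP => e e0; have [|f fe] := zu (e / 2); first by rewrite divr_gt0.
    exists (absfun f - F f).
      move=> t; have [r Er rf] := Fr f t; rewrite cfunDE cfunNE Er -rmorphB realc_ge0 //.
      by have := ler_norm r; rewrite /=; lra.
    have -> : m (absfun f - F f) z - (p - c) =
      (m (absfun f) z - p) - (m (F f) z - c) by module_eq X.
    apply: le_lt_trans (nrD _ _) _; rewrite nrN; have := pP f; have := cP f; lra.
  - rewrite -scalerBr -[RHS]two_halves; congr (_ *: _).
    by abel_at X.
have pcone : cyclic_cone m z p.
  apply/coneP => e /zu [f fe]; exists (absfun f); last exact: le_lt_trans (pP f) fe.
  by move=> t; rewrite realc_ge0 ?cabs_ge0.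
exists p; split => //; exists a, b; split.
- apply: (rp Refun) => // f t; exists (complex.Re (f t)) => //; exact: cabs_Re.
- apply: (rp Imfun) => // f t; exists (complex.Im (f t)) => //; exact: cabs_Im.
- apply/eqP; rewrite -subr_eq0; apply/eqP; apply: nr_small_eq0 => e e0.
  have [|f fe] := zu (e / 3); first by rewrite divr_gt0.
  have -> : u - (a + 'i *: b) = (m (Refun f) z - a) + 'i *: (m (Imfun f) z - b)
      - (m f z - u).
    by rewrite {3}(Re_Im_fun f); module_eq X.
  apply: le_trans (nrD3 _ _ _) _; rewrite nrN nrZi.
  by have := aP f; have := bP f; lra.
split.
- exact: cone_real_part.
- move=> _ [t _ <-]; apply/coneP => e e0.
  have [|f fe] := zu (e / 3); first by rewrite divr_gt0.
  exists (absfun f - ((cos t)%:C *: Refun f + (sin t)%:C *: Imfun f)).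
    move=> s; rewrite cfunDE cfunNE cfunDE !cfunZE /= -!rmorphM -rmorphD -rmorphB.
    rewrite realc_ge0 // subr_ge0 cabs_sqrt.
    exact: cos_sin_le.
  have -> : m (absfun f - ((cos t)%:C *: Refun f + (sin t)%:C *: Imfun f)) z -
      (p - ((cos t)%:C *: a + (sin t)%:C *: b)) = (m (absfun f) z - p)
      - (cos t)%:C *: (m (Refun f) z - a) - (sin t)%:C *: (m (Imfun f) z - b).
    by module_eq X.
  apply: le_lt_trans (nrD3 _ _ _) _; rewrite !nrN !nrZr.
  have A1 : `|cos t| * nr (m (Refun f) z - a) <= nr (m f z - u).
    apply: le_trans (aP f); rewrite ler_piMl ?nr_ge0 //.
    by rewrite ler_norml cos_geN1 cos_le1.
  have A2 : `|sin t| * nr (m (Imfun f) z - b) <= nr (m f z - u).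
    apply: le_trans (bP f); rewrite ler_piMl ?nr_ge0 //.
    by rewrite ler_norml sin_geN1 sin_le1.
  have := pP f; lra.
- move=> c cR cP; apply: (@modulus_lub _ _ _ m z a b p c) => //.
    move=> e /zu [f fe]; exists f; split.
    + exact: le_lt_trans (aP f) fe.
    + exact: le_lt_trans (bP f) fe.
    + exact: le_lt_trans (pP f) fe.
  by move=> t; apply: cP; exists t.
Qed.

(** A lower bound [b] of [p] and [q] satisfies [b <= h q + (1 - h) p], which is small since [h]
    nearly kills [v] and [1 - h] nearly kills [u]. *)
Lemma sep_lattice_disjoint z u v : cyclic m z u -> cyclic m z v ->
  sep m u v -> lattice_disjoint (cyclic_cone m z) u v.
Proof.
move=> zu zv uv.
have [p [pu pP]] := modulus_exists zu; have [q [qv qP]] := modulus_exists zv.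
have cone_of w s : cyclic m z w ->
    (forall f, nr (m (absfun f) z - s) <= nr (m f z - w)) -> cyclic_cone m z s.
  move=> /cyclicP zw sP; apply/coneP => e /zw [f fe].
  exists (absfun f); last exact: le_lt_trans (sP f) fe.
  by move=> t; rewrite realc_ge0 ?cabs_ge0.
exists p, q; split=> //; split.
- by apply: cone_real_part; exact: cone0.
- move=> _ [->|->]; rewrite /cone_le subr0.
    exact: (cone_of u).
  exact: (cone_of v).
- move=> b _ bP.
  have pb : cyclic_cone m z (p - b) by apply: bP; left.
  have qb : cyclic_cone m z (q - b) by apply: bP; right.
  apply/coneP => e e0; have e10 : 0 < e / 10 by rewrite divr_gt0.
  have [r1 r10 r1e] := (coneP m z _).1 pb _ e10.
  have [r2 r20 r2e] := (coneP m z _).1 qb _ e10.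
  have [h [h01 hu hv]] := uv _ e10.
  have [f fe] := (cyclicP m z u).1 zu _ e10.
  have [g ge] := (cyclicP m z v).1 zv _ e10.
  have h1 t : cabs (h t) <= 1 by have [] := cabs_unitc (h01 t).
  have h2 t : cabs ((1 - h) t) <= 1.
    by rewrite cfunDE cfunNE cfun1E; have [] := cabs_unitc (h01 t).
  (* A multiplier that nearly kills [w] nearly kills its modulus [s], as [k |f'|] and [k f'] have
     the same absolute value. *)
  have small k w s f' : (forall t, cabs (k t) <= 1) -> nr (m k w) < e / 10 ->
      nr (m f' z - w) < e / 10 ->
      (forall f, nr (m (absfun f) z - s) <= nr (m f z - w)) ->
      nr (m k s) < 3 * (e / 10).
    move=> k1 kw fw sP.
    have -> : m k s = m (k * absfun f') z - m k (m (absfun f') z - s) by module_eq X.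
    apply: le_lt_trans (nrD _ _) _; rewrite nrN.
    have : nr (m (k * absfun f') z) <= nr (m (k * f') z).
      apply: act_dom => t; rewrite !cfunME !cabsM /= cabs_real.
      by rewrite (ger0_norm (cabs_ge0 _)).
    have -> : m (k * f') z = m k (m f' z - w) + m k w by module_eq X.
    have := nrD (m k (m f' z - w)) (m k w).
    have := act_le1 m (m f' z - w) k1.
    have := act_le1 m (m (absfun f') z - s) k1; have := sP f'; lra.
  have E1 : nr (m (1 - h) p) < 3 * (e / 10).
    by apply: (small _ u _ f) => //; rewrite actB ck_act1.
  have E2 : nr (m h q) < 3 * (e / 10) by apply: (small _ v _ g).
  exists (h * r2 + (1 - h) * r1).
    move=> t; have /andP[ht0 ht1] := h01 t.
    by rewrite cfunDE !cfunME cfunDE cfunNE cfun1E addr_ge0 // mulr_ge0 // subr_ge0.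
  have -> : m (h * r2 + (1 - h) * r1) z - (0 - b) =
     m h (m r2 z - (q - b)) + m (1 - h) (m r1 z - (p - b)) + m h q + m (1 - h) p.
    by module_eq X.
  apply: le_lt_trans (nrD4 _ _ _ _) _.
  have := act_le1 m (m r2 z - (q - b)) h1.
  have := act_le1 m (m r1 z - (p - b)) h2; lra.
Qed.

(* The angles 0, pi, pi/2, -pi/2 give that |a| and |b| are at most p. Everything
   is doubled to avoid halves: f z approximates 2 u and k z approximates 4 p. *)
Lemma modulus_bound z u p e : is_modulus (cyclic_cone m z) u p -> 0 < e ->
  exists f k, [/\ nr (m f z - (u + u)) < e, nr (m k z - (p + p + (p + p))) < e &
    forall t, exists2 r : R, k t = r%:C & cabs (f t) <= r].
Proof.
move=> [a [b [_ _ -> [_ ub _]]]] e0.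
have e4 : 0 < e / 4 by rewrite divr_gt0.
have ubt (t : R) : cyclic_cone m z (p - ((cos t)%:C *: a + (sin t)%:C *: b)).
  by apply: ub; exists t.
have p1 : cyclic_cone m z (p - a).
  by have := ubt 0; rewrite cos0 sin0 scale1r scale0r addr0.
have p2 : cyclic_cone m z (p + a).
  have := ubt pi; rewrite cospi sinpi scale0r addr0.
  by rewrite rmorphN scaleN1r opprK.
have p3 : cyclic_cone m z (p - b).
  by have := ubt (pi / 2); rewrite cos_pihalf sin_pihalf scale1r scale0r add0r.
have p4 : cyclic_cone m z (p + b).
  have := ubt (- (pi / 2)); rewrite cosN sinN cos_pihalf sin_pihalf scale0r add0r.
  by rewrite rmorphN scaleN1r opprK.
have [q1 q10 q1e] := (coneP m z _).1 p1 _ e4.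
have [q2 q20 q2e] := (coneP m z _).1 p2 _ e4.
have [q3 q30 q3e] := (coneP m z _).1 p3 _ e4.
have [q4 q40 q4e] := (coneP m z _).1 p4 _ e4.
exists (q2 - q1 + 'i *: (q4 - q3)), (q1 + q2 + (q3 + q4)); split.
- have -> : m (q2 - q1 + 'i *: (q4 - q3)) z - (a + 'i *: b + (a + 'i *: b)) =
    (m q2 z - (p + a)) - (m q1 z - (p - a)) +
    'i *: (m q4 z - (p + b)) - 'i *: (m q3 z - (p - b)) by module_eq X.
  by apply: le_lt_trans (nrD4 _ _ _ _) _; rewrite !nrN !nrZi; lra.
- have -> : m (q1 + q2 + (q3 + q4)) z - (p + p + (p + p)) =
    (m q2 z - (p + a)) + (m q1 z - (p - a)) +
    (m q4 z - (p + b)) + (m q3 z - (p - b)) by module_eq X.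
  by apply: le_lt_trans (nrD4 _ _ _ _) _; lra.
move=> t; have [a1 E1] := nnegcE (q10 t); have [a2 E2] := nnegcE (q20 t).
have [a3 E3] := nnegcE (q30 t); have [a4 E4] := nnegcE (q40 t).
exists (complex.Re (q1 t) + complex.Re (q2 t) + (complex.Re (q3 t) + complex.Re (q4 t))).
  by rewrite !cfunDE [in LHS]E1 [in LHS]E2 [in LHS]E3 [in LHS]E4 !rmorphD.
have -> : (q2 - q1 + 'i *: (q4 - q3)) t =
   (complex.Re (q2 t) - complex.Re (q1 t)) +i* (complex.Re (q4 t) - complex.Re (q3 t)).
  rewrite !cfunDE cfunZE !cfunDE !cfunNE [in LHS]E1 [in LHS]E2 [in LHS]E3 [in LHS]E4.
  by simpc.
apply: le_trans (cabs_le_ReIm _) _ => /=.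
by apply: lerD; rewrite ler_norml; lra.
Qed.

(** For [w = |2u| /\ |2v|], the functions of [modulus_bound] show that [w / 4] is a lower bound of
    [p] and [q]. Hence [w <= 0]; as [w] is in the cone, it is 0 and [meet0_sep] applies. *)
Lemma lattice_disjoint_sep z u v : cyclic m z u -> cyclic m z v ->
  lattice_disjoint (cyclic_cone m z) u v -> sep m u v.
Proof.
move=> zu zv [p [q [pu qv [_ _ glb]]]].
have dbl w : cyclic m z w -> cyclic m z (w + w).
  move=> /cyclicP zw; apply/cyclicP => e e0.
  have [|f fe] := zw (e / 2); first by rewrite divr_gt0.
  exists (f + f).
  have -> : m (f + f) z - (w + w) = (m f z - w) + (m f z - w) by module_eq X.
  by rewrite nr_double; lra.
have [w wP] := meet_exists (dbl _ zu) (dbl _ zv).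
have wcone : cyclic_cone m z w.
  apply/coneP => e e0; have e2 : 0 < e / 2 by rewrite divr_gt0.
  have [f fe] := (cyclicP m z _).1 (dbl _ zu) _ e2.
  have [g ge] := (cyclicP m z _).1 (dbl _ zv) _ e2.
  exists (minfun f g); last by have := wP f g; lra.
  by move=> t; rewrite minfunE realc_ge0 // le_min !cabs_ge0.
have bnd s : (forall e, 0 < e -> exists f g k,
     [/\ nr (m f z - (u + u)) < e, nr (m g z - (v + v)) < e,
      nr (m k z - (s + s + (s + s))) < e & forall t, exists2 r : R, k t = r%:C &
        Num.min (cabs (f t)) (cabs (g t)) <= r]) ->
    cyclic_cone m z (s - (4^-1 : R)%:C *: w).
  move=> sP.
  have -> : s - (4^-1 : R)%:C *: w = (4^-1 : R)%:C *: (s + s + (s + s) - w).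
    rewrite scalerBr -[in LHS](two_halves s) -[in LHS](two_halves (s + s)).
    rewrite scalerA -rmorphM /=; congr ((_%:C) *: _ - _).
    by rewrite -invfM -natrM.
  apply: coneZ; first by rewrite invr_gt0.
  apply/coneP => e e0; have [|f [g [k [fe ge ke kP]]]] := sP (e / 3).
    by rewrite divr_gt0.
  exists (k - minfun f g).
    move=> t; have [r Er rP] := kP t.
    by rewrite cfunDE cfunNE minfunE Er -rmorphB realc_ge0 // subr_ge0.
  have -> : m (k - minfun f g) z - (s + s + (s + s) - w) =
    (m k z - (s + s + (s + s))) - (m (minfun f g) z - w) by module_eq X.
  by apply: le_lt_trans (nrD _ _) _; rewrite nrN; have := wP f g; lra.
have w4 : cyclic_cone m z (0 - (4^-1 : R)%:C *: w).
  apply: glb.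
    by apply: cone_real_part; apply: coneZ => //; rewrite invr_gt0.
  move=> s sE; apply: bnd => e e0.
  have [f [k [fe ke fk]]] := modulus_bound pu e0.
  have [g [k' [ge ke' gk]]] := modulus_bound qv e0.
  case: sE => ->; exists f, g; [exists k|exists k']; split=> // t.
    by have [r -> fr] := fk t; exists r => //; rewrite ge_min fr.
  by have [r -> fr] := gk t; exists r => //; rewrite ge_min fr orbT.
have w0 : w = 0.
  apply: (cone_anti wcone); have -> : - w = (4 : R)%:C *: (0 - (4^-1 : R)%:C *: w).
    by rewrite sub0r scalerN scalerA -rmorphM mulfV ?pnatr_eq0 // scale1r.
  exact: coneZ.
have S : sep m (u + u) (v + v).
  apply: (meet0_sep (dbl _ zu) (dbl _ zv)) => f g.
  by have := wP f g; rewrite w0 subr0.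
(* Undoes the doubling: tolerance [2 * e] for [u + u] and [v + v] is tolerance [e] for [u] and
   [v]. *)
move=> e e0; have [|h [h01 hu hv]] := S (2 * e); first by rewrite mulr_gt0.
exists h; split=> //.
  have E : u + u - m h (u + u) = (u - m h u) + (u - m h u) by module_eq X.
  by rewrite E nr_double in hu; lra.
by rewrite act_addx nr_double in hv; lra.
Qed.

End LatticeDisjoint.

(** * Separation-preserving operators *)

Section Ramps.
Context {R : realType}.
Implicit Types y : R.

(** At [y = N f - k] the next three functions are the [a_k], [l_k] and [g_k] of the overview:
    [ramp_up] lives on [y > 1/2], [ramp_lo] on [y < 1/2], and [tent] on [0 < y < 1] with peak at
    [1/2]. *)
Definition clamp y : R := Num.max 0 (Num.min 1 y).
Definition ramp_up y : R := Num.max 0 (2 * clamp y - 1).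
Definition ramp_lo y : R := Num.max 0 (1 - 2 * clamp y).
Definition tent y : R := 1 - `|2 * clamp y - 1|.

Lemma clamp_bounds y : 0 <= clamp y <= 1.
Proof. by rewrite /clamp maxEle minEle; do ![case: ifPn]; rewrite -?ltNge; lra. Qed.

Lemma clamp_cont : continuous clamp.
Proof.
move=> y; apply: (@continuous_max R R (fun=> 0) (fun y => Num.min 1 y)).
  exact: cvg_cst.
by apply: (@continuous_min R R (fun=> 1) id); [exact: cvg_cst|exact: cvg_id].
Qed.

Lemma affine_clamp_cont (a b : R) : continuous (fun y => a * clamp y + b).
Proof.
move=> y; apply: cvgD; last exact: cvg_cst.
by apply: cvgM; [exact: cvg_cst|exact: clamp_cont].
Qed.

Lemma ramp_up_cont : continuous ramp_up.
Proof.
move=> y; apply: (@continuous_max R R (fun=> 0) (fun y => 2 * clamp y - 1)).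
  exact: cvg_cst.
exact: affine_clamp_cont.
Qed.

Lemma ramp_lo_cont : continuous ramp_lo.
Proof.
move=> y; apply: (@continuous_max R R (fun=> 0) (fun y => 1 - 2 * clamp y)).
  exact: cvg_cst.
by apply: cvgB; [exact: cvg_cst|apply: cvgM; [exact: cvg_cst|exact: clamp_cont]].
Qed.

Lemma tent_cont : continuous tent.
Proof.
move=> y; apply: cvgB; first exact: cvg_cst.
by apply: cvg_norm; exact: affine_clamp_cont.
Qed.

Lemma ramp_disjoint y : ramp_up y * ramp_lo y = 0.
Proof.
rewrite /ramp_up /ramp_lo !maxEle; do ![case: ifPn]; rewrite -?ltNge ?mul0r ?mulr0 //.
by move=> h h'; have -> : 2 * clamp y - 1 = 0; [lra|rewrite mul0r].
Qed.

Lemma ramp_partition y : ramp_up y + ramp_lo y + tent y = 1.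
Proof.
rewrite /ramp_up /ramp_lo /tent !maxEle.
case: (ger0P (2 * clamp y - 1)) => h; case: (ger0P (1 - 2 * clamp y)) => h'.
all: lra.
Qed.

Lemma clamp_split y : clamp y = ramp_up y + 2^-1 * tent y.
Proof.
rewrite /ramp_up /tent maxEle.
by case: (ger0P (2 * clamp y - 1)) => h; lra.
Qed.

Lemma tent_le1 y : `|tent y| <= 1.
Proof.
have := clamp_bounds y; rewrite /tent ler_norml.
by case: (ger0P (2 * clamp y - 1)) => h; lra.
Qed.

(** Either [y <= j], where the second tent vanishes, or [y > j >= i + 1], where the first does. *)
Lemma tent_disjoint y (i j : nat) : (i < j)%N -> tent (y - i%:R) * tent (y - j%:R) = 0.
Proof.
rewrite -(ler_nat R) -natr1 => ij.
have T0 (u : R) : u <= 0 -> tent u = 0.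
  move=> u0; have -> : tent u = 1 - `|2 * 0 - 1|.
    rewrite /tent; congr (_ - `|_ * _ - _|); rewrite /clamp maxEle minEle.
    by do ![case: ifPn]; rewrite -?ltNge; lra.
  by rewrite mulr0 sub0r normrN1 subrr.
have T1 (u : R) : 1 <= u -> tent u = 0.
  move=> u1; have -> : tent u = 1 - `|2 * 1 - 1|.
    rewrite /tent; congr (_ - `|_ * _ - _|); rewrite /clamp maxEle minEle.
    by do ![case: ifPn]; rewrite -?ltNge; lra.
  by rewrite mulr1 ger0_norm; lra.
have [h|h] := leP (y - j%:R) 0; first by rewrite (T0 _ h) mulr0.
by rewrite T1 ?mul0r //; lra.
Qed.

Lemma clamp_sum n y : 0 <= y -> y <= n%:R -> \sum_(k < n) clamp (y - k%:R) = y.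
Proof.
move=> y0 yn.
(* Level [k] contributes the part of [y] between [k] and [k + 1], so partial sums truncate [y]; this
   form goes through the induction. *)
have H N : \sum_(k < N) clamp (y - k%:R) = Num.min y N%:R.
  elim: N => [|N IH]; first by rewrite big_ord0 minEle; case: ifPn => //; lra.
  rewrite big_ord_recr /= IH /clamp -natr1 !minEle maxEle.
  by do ![case: ifPn]; rewrite -?ltNge; lra.
by rewrite H minEle yn.
Qed.

End Ramps.

(** * Separation-preserving operators respect cyclic subspaces *)

Section Main.
Context {R : realType} {KX KY : topologicalType}.
Hypothesis KXc : compact [set: KX].
Context {X Y : completeNormedModType R[i]}.
Variables (mX : ck_module KX X) (mY : ck_module KY Y) (T : {linear X -> Y}).
Variables (C : R) (C0 : 0 < C) (TC : forall x, nr (T x) <= C * nr x).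
Implicit Types (f g h k : Cfun R KX) (x y z u v w : X).

Lemma T_sub u v : T (u - v) = T u - T v. Proof. exact: linearB. Qed.
Lemma T_add u v : T (u + v) = T u + T v. Proof. exact: linearD. Qed.

(** At each point [f] or [g] vanishes, so [min(|f'|, |g'|) <= |f' - f| + |g' - g|], which is the
    hypothesis of [meet0_sep]. *)
Lemma mul0_sep f g x : (forall t, f t * g t = 0) -> sep mX (mX f x) (mX g x).
Proof.
move=> fg; apply: (@meet0_sep _ _ _ mX x).
- by apply/cyclicP => e e0; exists f; rewrite subrr nr0.
- by apply/cyclicP => e e0; exists g; rewrite subrr nr0.
move=> f' g'; rewrite -!actB; apply: act_dom2 => t.
rewrite cabs_minfun !cfunDE !cfunNE.
have /eqP := fg t; rewrite mulf_eq0 => /orP[/eqP ->|/eqP ->].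
  by rewrite subr0 ge_min lerDl cabs_ge0.
by rewrite subr0 ge_min lerDr cabs_ge0 orbT.
Qed.

Hypothesis Tsep : forall u v, sep mX u v -> sep mY (T u) (T v).

(* One multiplier d of norm at most 1 serves all the summands, so the sum of the
   c_i T(gam_i x) is no larger than T((sum_i gam_i) x). *)
Lemma sep_sum_multiplier x (c : nat -> Cfun R KY) (gam : nat -> Cfun R KX) n e :
  (forall i t, cabs (c i t) <= 1) ->
  (forall i j t, (i < j)%N -> gam i t * gam j t = 0) -> 0 < e ->
  exists2 d : Cfun R KY, (forall t, cabs (d t) <= 1) &
    nr (\sum_(i < n) mY (c i) (T (mX (gam i) x))
        - mY d (T (mX (\sum_(i < n) gam i) x))) <= e.
Proof.
move=> c1 gam0; elim: n e => [|n IH] e e0.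
  exists 0 => [t|]; first by rewrite cfun0E /cabs normr0.
  by rewrite !big_ord0 act0 subrr nr0 ltW.
have [|d d1 de] := IH (e / 5); first by rewrite divr_gt0.
set s := \sum_(i < n) gam i in de *.
have sg t : s t * gam n t = 0.
  rewrite /s; elim/big_ind: _ => [|p q ph qh|i _]; first by rewrite cfun0E mul0r.
    by rewrite cfunDE mulrDl ph qh addr0.
  by apply: gam0.
have [|h [h01 hs hg]] := Tsep (mul0_sep x sg) (e := e / 5); first by rewrite divr_gt0.
have h1 t : cabs (h t) <= 1 by have [] := cabs_unitc (h01 t).
have h2 t : cabs ((1 - h) t) <= 1.
  by rewrite cfunDE cfunNE cfun1E; have [] := cabs_unitc (h01 t).
(* [h] nearly fixes the image of the earlier sum and nearly kills that of the new term, so [d] is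
   kept on the former and [c n] acts on the latter. *)
exists (d * h + c n * (1 - h)).
  by move=> t; rewrite !cfunDE !cfunME cfunDE cfunNE; exact: unitc_convex.
rewrite !big_ord_recr /= -/s (ck_actD mX) T_add.
set A := \sum_(i < n) _ in de *.
have -> : A + mY (c n) (T (mX (gam n) x)) -
   mY (d * h + c n * (1 - h)) (T (mX s x) + T (mX (gam n) x)) =
  (A - mY d (T (mX s x))) + mY d (T (mX s x) - mY h (T (mX s x))) +
  (mY (c n) (mY h (T (mX (gam n) x))) - mY d (mY h (T (mX (gam n) x))))
  - mY (c n) (T (mX s x) - mY h (T (mX s x))) by module_eq Y.
apply: le_trans (nrD4 _ _ _ _) _; rewrite nrN.
have := nrD (mY (c n) (mY h (T (mX (gam n) x)))) (- mY d (mY h (T (mX (gam n) x)))).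
rewrite nrN.
have := act_le1 mY (T (mX s x) - mY h (T (mX s x))) d1.
have := act_le1 mY (T (mX s x) - mY h (T (mX s x))) (c1 n).
have := act_le1 mY (mY h (T (mX (gam n) x))) d1.
have := act_le1 mY (mY h (T (mX (gam n) x))) (c1 n); lra.
Qed.


(** The bound does not grow with [n]: [C * nr x] comes from the sum of the tents, 1 from the common
    multiplier and 1 from the separation errors. *)
Lemma cyclic_level n (phi : KX -> R) (phic : continuous phi) x :
  (forall t, 0 <= phi t <= 1) ->
  exists H : Cfun R KY,
    nr (n%:R%:C *: T (mX (rfun phic) x) - mY H (T x)) <= C * nr x + 2.
Proof.
move=> phi01.
have Gc (G : R -> R) : continuous G ->
    forall k : nat, continuous (fun t => G (n%:R * phi t - k%:R)).
  move=> Gcont k t; apply: (@continuous_comp _ _ _ (fun t => n%:R * phi t - k%:R) G).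
    apply: cvgB; last exact: cvg_cst.
    by apply: cvgM; [exact: cvg_cst|exact: phic].
  exact: Gcont.
pose up (k : nat) := rfun (Gc _ (@ramp_up_cont R) k).
pose lo (k : nat) := rfun (Gc _ (@ramp_lo_cont R) k).
pose gam (k : nat) := rfun (Gc _ (@tent_cont R) k).
have gam0 i j t : (i < j)%N -> gam i t * gam j t = 0.
  by move=> ij; rewrite /= -rmorphM tent_disjoint.
have gam1 : forall t, cabs ((\sum_(i < n) gam i) t) <= 1.
  move=> t; elim: (n) => [|N IH]; first by rewrite big_ord0 cfun0E /cabs normr0.
  have -> : (\sum_(i < N.+1) gam i) t = (\sum_(i < N) gam i) t + gam N t.
    by rewrite big_ord_recr.
  have : (\sum_(i < N) gam i) t * gam N t = 0.
    elim/big_ind: _ => [|p q ph qh|i _]; first by rewrite cfun0E mul0r.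
      by rewrite cfunDE mulrDl ph qh addr0.
    exact: gam0.
  move=> /eqP; rewrite mulf_eq0 => /orP[/eqP ->|/eqP ->]; last by rewrite addr0.
  by rewrite add0r /= cabs_real tent_le1.
(* Two errors below [del] occur at each of the [n] levels; [n.+1] in the witness covers [n = 0]. *)
have [del del0 deln] : exists2 del : R, 0 < del & n%:R * (2 * del) <= 1.
  exists (2 * n.+1%:R)^-1; first by rewrite invr_gt0 mulr_gt0.
  rewrite invfM (mulrA 2) divff ?pnatr_eq0 // mul1r ler_pdivrMr // mul1r.
  by rewrite ler_nat.
have uplo (k : nat) t : up k t * lo k t = 0 by rewrite /= -rmorphM ramp_disjoint.
have /choice[h hP] : forall k : nat, exists h : Cfun R KY, [/\ forall t, 0 <= h t <= 1,
    nr (T (mX (up k) x) - mY h (T (mX (up k) x))) < del &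
    nr (mY h (T (mX (lo k) x))) < del].
  by move=> k; exact: Tsep (mul0_sep x (uplo k)) _ del0.
(* [n f] contains half of each tent, while [h k] also acts on the tent part of [T x]: the difference
   is this coefficient. *)
pose c (k : nat) : Cfun R KY := (2^-1 : R)%:C *: (1 : Cfun R KY) - h k.
have c1 (k : nat) t : cabs (c k t) <= 1.
  rewrite /c cfunDE cfunNE cfunZE cfun1E mulr1.
  have [/(_ t)/unitcE[h0 h1 ->] _ _] := hP k.
  by rewrite -rmorphB cabs_real ler_norml; lra.
have [d d1 de] := sep_sum_multiplier x n c1 gam0 ltr01.
exists (\sum_(k < n) h k).
have nF : n%:R%:C *: rfun phic = \sum_(k < n) (up k + (2^-1 : R)%:C *: gam k).
  apply/continuousEP => t; rewrite cfunZE /= -rmorphM.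
  have E : forall N, (\sum_(k < N) (up k + (2^-1 : R)%:C *: gam k)) t =
      (\sum_(k < N) clamp (n%:R * phi t - k%:R))%:C.
    elim=> [|N IH]; first by rewrite !big_ord0.
    have -> : (\sum_(k < N.+1) (up k + (2^-1 : R)%:C *: gam k)) t =
        (\sum_(k < N) (up k + (2^-1 : R)%:C *: gam k)) t
        + (up N t + (2^-1 : R)%:C * gam N t) by rewrite big_ord_recr.
    by rewrite big_ord_recr IH /= -rmorphM -!rmorphD -clamp_split.
  have /andP[p0 p1] := phi01 t.
  by rewrite E clamp_sum ?mulr_ge0 // ler_piMr.
have -> : n%:R%:C *: T (mX (rfun phic) x) - mY (\sum_(k < n) h k) (T x) =
  \sum_(k < n) mY (c k) (T (mX (gam k) x)) +
  \sum_(k < n) (T (mX (up k) x) - mY (h k) (T (mX (up k) x))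
     - mY (h k) (T (mX (lo k) x))).
  have -> : n%:R%:C *: T (mX (rfun phic) x) =
    T (mX (n%:R%:C *: rfun phic) x) by rewrite ck_actZ [RHS]linearZ.
  rewrite nF -big_split /=.
  have key (k : nat) : T x = T (mX (up k) x) + T (mX (lo k) x) + T (mX (gam k) x).
    rewrite -!T_add -!ck_actD.
    have -> : up k + lo k + gam k = 1.
      by apply/continuousEP => t; rewrite !cfunDE /= -!rmorphD ramp_partition.
    by rewrite ck_act1.
  elim: (n) => [|N IH]; first by rewrite !big_ord0 !act0 linear0 subrr.
  rewrite !big_ord_recr /= -IH !(ck_actD mX) (ck_actD mY (\sum_(i < N) h i)).
  rewrite !T_add [mY (h N) (T x)](congr1 _ (key N)) (ck_actZ mX) [T (_ *: _)]linearZ /=.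
  set S := mY (\sum_(i < N) h i) _; rewrite /c.
  by module_eq Y.
have C1 : nr (mY d (T (mX (\sum_(i < n) gam i) x))) <= C * nr x.
  apply: le_trans (act_le1 _ _ d1) _; apply: le_trans (TC _) _.
  by rewrite ler_pM2l // act_le1.
have C2 : nr (\sum_(k < n) (T (mX (up k) x) - mY (h k) (T (mX (up k) x))
     - mY (h k) (T (mX (lo k) x)))) <= n%:R * (2 * del).
  elim: (n) => [|N IH]; first by rewrite big_ord0 nr0 mul0r.
  rewrite big_ord_recr /= -natr1 mulrDl mul1r.
  apply: le_trans (nrD _ _) _; apply: lerD IH _.
  have [_ ha hb] := hP N.
  by apply: le_trans (nrD _ _) _; rewrite nrN; lra.
set A := \sum_(k < n) mY (c k) _ in de *.
set B := \sum_(k < n) _ in C2 *.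
have := nrD A B; have := nrD (A - mY d (T (mX (\sum_(i < n) gam i) x)))
   (mY d (T (mX (\sum_(i < n) gam i) x))); rewrite subrK; lra.
Qed.

(** Dividing the estimate of [cyclic_level] by a large [n] makes the error arbitrarily small. *)
Lemma T_level_cyclic (phi : KX -> R) (phic : continuous phi) x :
  (forall t, 0 <= phi t <= 1) -> cyclic mY (T x) (T (mX (rfun phic) x)).
Proof.
move=> phi01; apply/cyclicP => e e0.
pose n := (Num.truncn ((C * nr x + 2) / e)).+1.
have nP : (C * nr x + 2) / e < n%:R by exact: truncnS_gt.
have [H HP] := @cyclic_level n phi phic x phi01.
have n0 : 0 < n%:R :> R by rewrite ltr0n.
exists ((n%:R^-1)%:C *: H).
have -> : mY ((n%:R^-1)%:C *: H) (T x) - T (mX (rfun phic) x) =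
  - ((n%:R^-1)%:C *: (n%:R%:C *: T (mX (rfun phic) x) - mY H (T x))).
  rewrite ck_actZ scalerBr scalerA -rmorphM mulVf ?gt_eqF // scale1r.
  by rewrite opprB.
rewrite nrN nrZr gtr0_norm ?invr_gt0 // mulrC ltr_pdivrMr //.
by apply: le_lt_trans HP _; rewrite [e * _]mulrC -ltr_pdivrMr.
Qed.

Lemma T_act_cyclic f x : cyclic mY (T x) (T (mX f x)).
Proof.
have [M M0 fM] := cfun_bounded KXc f.
have level (r : KX -> R) (rc : continuous r) : (forall t, `|r t| <= M) ->
    cyclic mY (T x) (T (mX (rfun rc) x)).
  (* Affine rescaling of [[-M, M]] to [[0, 1]]; the constant part contributes a multiple of
     [T x]. *)
  move=> rM; pose phi t := (r t / M + 1) / 2.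
  have phic : continuous phi.
    move=> t; apply: cvgM; last exact: cvg_cst.
    apply: cvgD; last exact: cvg_cst.
    by apply: cvgM; [exact: rc|exact: cvg_cst].
  have phi01 t : 0 <= phi t <= 1.
    have : `|r t / M| <= 1.
      by rewrite normrM normfV (gtr0_norm M0) ler_pdivrMr // mul1r.
    by rewrite ler_norml /phi; lra.
  have -> : rfun rc = (2 * M)%:C *: rfun phic - M%:C *: (1 : Cfun R KX).
    apply/continuousEP => t; rewrite cfunDE cfunNE !cfunZE cfun1E mulr1 /=.
    rewrite -rmorphM -rmorphB; congr (_%:C); rewrite /phi.
    by field; rewrite gt_eqF.
  rewrite actB !ck_actZ ck_act1 T_sub ![T (_ *: _)]linearZ -scaleNr.
  apply: cyclicD; apply: cyclicZ; first exact: T_level_cyclic.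
  exact: cyclic_self.
rewrite (Re_Im_fun f) ck_actD ck_actZ T_add [T ('i *: _)]linearZ.
apply: cyclicD; last apply: cyclicZ; apply: level => t.
  by apply: le_trans (fM t); exact: cabs_Re.
by apply: le_trans (fM t); exact: cabs_Im.
Qed.

Lemma T_cyclic x u : cyclic mX x u -> cyclic mY (T x) (T u).
Proof.
move=> /cyclicP xu; apply/cyclicP => e e0.
have [|f fe] := xu (e / 2 / C); first by rewrite !divr_gt0.
have [|g ge] := (cyclicP mY (T x) _).1 (@T_act_cyclic f x) (e / 2).
  by rewrite divr_gt0.
exists g; have := nr_tri (T (mX f x)) (mY g (T x)) (T u).
have := TC (mX f x - u); rewrite T_sub.
move: fe; rewrite ltr_pdivlMr // [_ * C]mulrC; lra.
Qed.

End Main.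

(** Both implications pass through [sep], which describes module disjointness and lattice
    disjointness alike. *)
Theorem theorem7p7 (R : realType) (KX KY : topologicalType)
    (KX_compact : compact [set: KX]) (KX_hausdorff : hausdorff_space KX)
    (KY_compact : compact [set: KY]) (KY_hausdorff : hausdorff_space KY)
    (X Y : completeNormedModType R[i])
    (mX : ck_module KX X) (mY : ck_module KY Y)
    (T : {linear X -> Y}) (T_bounded : bounded_near T (nbhs (0 : X))) :
  (forall x y : X, ck_disjoint mX x y -> ck_disjoint mY (T x) (T y)) <->
  (forall x : X,
     T @` cyclic mX x `<=` cyclic mY (T x) /\
     disjointness_preserving (cyclic mX x) (cyclic_cone mX x)
       (cyclic_cone mY (T x)) T).
Proof.
have [C C0 TC] := bounded_nrP T_bounded.
split=> [T1 x|T2 x y xy].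
- have Tsep u v : sep mX u v -> sep mY (T u) (T v).
    by move=> uv; apply/(disjointP KY_compact)/T1/(disjointP KX_compact).
  have Tx := T_cyclic KX_compact C0 TC Tsep.
  split; first by move=> _ [u xu <-]; exact: Tx.
  move=> u v xu xv uv; apply: sep_lattice_disjoint.
  + exact: Tx.
  + exact: Tx.
  + by apply: Tsep; exact: (lattice_disjoint_sep xu xv uv).
- have sxy := (disjointP KX_compact mX x y).1 xy.
  (* Disjointness places [x] and [y] in one cyclic subspace, that of [x + y], where the lattice
     condition can be applied. *)
  have xyc : cyclic mX (x + y) x /\ cyclic mX (x + y) y.
    have [Dxy _] := xy.
    split; apply: (Delta_cyclic KX_compact); rewrite Dxy.
      exists x; first exact: Delta_self.
      by exists 0; [exact: Delta0|rewrite addr0].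
    exists 0; first exact: Delta0.
    by exists y; [exact: Delta_self|rewrite add0r].
  case: xyc => xc yc; have [Tc Td] := T2 (x + y).
  apply/(disjointP KY_compact); apply: (lattice_disjoint_sep (z := T (x + y))).
  + by apply: Tc; exists x.
  + by apply: Tc; exists y.
  + by apply: Td => //; exact: (sep_lattice_disjoint xc yc sxy).
Qed.
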